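(* Let $N\in\mathbb{N}$, let $\Omega\subset\mathbb{R}^N$ be a bounded convex domain, and let $N<q\le\infty$. Then $$\|u-u_\Omega\|_{L^\infty(\Omega)}\le D_\infty(\Omega)\,\|\nabla u\|_{L^q(\Omega)}\quad\text{for all }u\in W^{1,q}(\Omega)$$ with $$D_\infty(\Omega)=\frac{d_\Omega^{\,N}}{N|\Omega|}\,\big\||x|^{1-N}\big\|_{L^{q'}(V)},$$ where $\Omega_x:=\{x-y\mid y\in\Omega\}$ for $x\in\Omega$ and $V:=\bigcup_{x\in\Omega}\Omega_x$.
   Context: A domain is a nonempty connected open set. $d_\Omega:=\sup_{x,y\in\Omega}|x-y|$ is the diameter of $\Omega$, with $|\cdot|$ the Euclidean norm on $\mathbb{R}^N$; $|\Omega|$ is the Lebesgue measure of $\Omega$; $u_\Omega=|\Omega|^{-1}\int_\Omega u(x)\,dx$. $q'$ is the Hölder conjugate of $q$: $q'=\frac{q}{q-1}$ if $1<q<\infty$, and $q'=1$ if $q=\infty$. $\big\||x|^{1-N}\big\|_{L^{q'}(V)}$ is the $L^{q'}(V)$-norm of the function $x\mapsto|x|^{1-N}$. Functions $u$ are real-valued, $\nabla u$ is the weak gradient, and $\|\nabla u\|_{L^q(\Omega)}:=\||\nabla u|\|_{L^q(\Omega)}$ with $|\nabla u|$ the pointwise Euclidean norm. *)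

(* Defs.v *)
From HB Require Import structures.
From mathcomp Require Import all_boot all_order all_algebra.
From mathcomp Require Import all_classical all_reals all_analysis.
Set Implicit Arguments.
Unset Strict Implicit.
Unset Printing Implicit Defensive.
Import Order.TTheory GRing.Theory Num.Theory.
Import numFieldNormedType.Exports.
Local Open Scope classical_set_scope.
Local Open Scope ring_scope.

Definition measure_rV_display : measure_display -> measure_display.
Proof. exact. Qed.

(* Product sigma-algebra on row vectors, generated by the coordinate maps
   (the Borel sigma-algebra when T is the real line). *)
Section measurable_rV.
Context {d} {T : sigmaRingType d}.
Variable n : nat.

Let coors : 'I_n -> 'rV[T]_n -> T := fun i x => x ord0 i.

Let rV_set0 : g_sigma_preimage coors set0.
Proof. exact: sigma_algebra0. Qed.

Let rV_setC A : g_sigma_preimage coors A -> g_sigma_preimage coors (~` A).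
Proof. exact: sigma_algebraC. Qed.

Let rV_bigcup (F : _^nat) : (forall i, g_sigma_preimage coors (F i)) ->
  g_sigma_preimage coors (\bigcup_i (F i)).
Proof. exact: sigma_algebra_bigcup. Qed.

HB.instance Definition _ := @isMeasurable.Build (measure_rV_display d)
  'rV[T]_n (g_sigma_preimage coors) rV_set0 rV_setC rV_bigcup.

End measurable_rV.

Lemma measurable_coor d (T : sigmaRingType d) n (i : 'I_n) :
  measurable_fun [set: 'rV[T]_n] (fun x : 'rV[T]_n => x ord0 i).
Proof.
move=> _ Y mY; rewrite setTI; apply: sub_sigma_algebra => /=.
rewrite -bigcup_seq/=; exists i => /=; first by rewrite mem_index_enum.
by exists Y => //; rewrite setTI.
Qed.

Lemma measurable_fun_coorP d1 d2 (T1 : measurableType d1)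
    (T2 : measurableType d2) n (f : T1 -> 'rV[T2]_n) :
  (forall i, measurable_fun [set: T1] (fun x => f x ord0 i)) ->
  measurable_fun [set: T1] f.
Proof.
move=> mf _.
change ((@measurable _ 'rV[T2]_n) `<=`
  [set A | measurable (setT `&` f @^-1` A)]).
apply: smallest_sub.
  split => /=; first by rewrite preimage_set0 setI0.
  - by move=> A; rewrite !setTI setTD preimage_setC; exact: measurableC.
  - move=> F mF; rewrite setTI preimage_bigcup; apply: bigcupT_measurable => k.
    by rewrite -[X in measurable X]setTI; exact: mF.
move=> A; rewrite -bigcup_seq/= => -[i _ [B mB <-]].
have := mf i measurableT B mB.
by rewrite /= !setTI.
Qed.

Section lebesgue_rV.
Context {R : realType}.

Definition cons_rV n (p : R * 'rV[R]_n) : 'rV[R]_n.+1 :=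
  row_mx (p.1)%:M p.2.

Lemma measurable_cons_rV n : measurable_fun setT (@cons_rV n).
Proof.
apply: measurable_fun_coorP => i.
have [j ->|j ->] := fintype.split_ordP (i : 'I_(1 + n)).
  rewrite (_ : (fun _ => _) = fst)//.
  apply/funext => p; apply: (eq_trans (row_mxEl _ _ _ _)).
  by rewrite !ord1 mxE.
rewrite (_ : (fun _ => _) = (fun x : 'rV[R]_n => x ord0 j) \o snd).
  by apply: measurableT_comp => //; exact: measurable_coor.
by apply/funext => p; exact: row_mxEr.
Qed.

Definition uncons_rV n (x : 'rV[R]_n.+1) : R * 'rV[R]_n :=
  (x ord0 ord0, \row_j x ord0 (lift ord0 j)).

Lemma cons_rVK n : cancel (@cons_rV n) (@uncons_rV n).
Proof.
case=> a v; rewrite /uncons_rV /cons_rV /=; congr pair.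
  rewrite (_ : ord0 = @lshift 1 n ord0); last exact/val_inj.
  by apply: (eq_trans (row_mxEl _ _ _ _)); rewrite mxE.
apply/rowP => j; rewrite mxE (_ : lift ord0 j = rshift 1 j); last exact/val_inj.
exact: row_mxEr.
Qed.

Lemma measurable_uncons_rV n : measurable_fun setT (@uncons_rV n).
Proof.
apply/measurable_fun_pairP; split; first exact: measurable_coor.
apply: measurable_fun_coorP => j /=.
by under eq_fun do rewrite mxE; exact: measurable_coor.
Qed.

Section cons_measure.
Variables (n : nat) (m : {sigma_finite_measure set 'rV[R]_n -> \bar R}).

Definition lebesgue_cons : set 'rV[R]_n.+1 -> \bar R :=
  pushforward (lebesgue_measure \x m)%E (@cons_rV n).

Let lebesgue_cons0 : lebesgue_cons set0 = 0%E.
Proof. by rewrite /lebesgue_cons /pushforward preimage_set0 measure0. Qed.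

Let lebesgue_cons_ge0 A : (0 <= lebesgue_cons A)%E.
Proof. by rewrite /lebesgue_cons /pushforward; exact: measure_ge0. Qed.

Let lebesgue_cons_sigma_additive : semi_sigma_additive lebesgue_cons.
Proof.
move=> F mF tF mUF; rewrite /lebesgue_cons /pushforward preimage_bigcup.
apply: measure_semi_sigma_additive.
- by move=> k; rewrite -[X in measurable X]setTI; exact: measurable_cons_rV.
- apply/trivIsetP => i j _ _ ij; rewrite -preimage_setI.
  by move/trivIsetP : tF => /(_ _ _ _ _ ij) ->//; rewrite preimage_set0.
- rewrite -preimage_bigcup -[X in measurable X]setTI.
  exact: measurable_cons_rV.
Qed.

HB.instance Definition _ := isMeasure.Build _ _ _ lebesgue_cons
  lebesgue_cons0 lebesgue_cons_ge0 lebesgue_cons_sigma_additive.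

Let lebesgue_cons_sigma_finite : sigma_finite setT lebesgue_cons.
Proof.
have /sigma_finiteP[F [TF ndF Foo]] := sigma_finiteT (@lebesgue_measure R).
have /sigma_finiteP[G [TG ndG Goo]] := sigma_finiteT m.
exists (fun k => @uncons_rV n @^-1` (F k `*` G k)).
  rewrite -preimage_bigcup; apply/esym/seteqP; split => // x _ /=.
  have [i _ Fi] : (\bigcup_k F k) (x ord0 ord0) by rewrite -TF.
  have [j _ Gj] : (\bigcup_k G k) (uncons_rV x).2 by rewrite -TG.
  exists (maxn i j) => //; split.
    by apply: (subsetPset _ _ (ndF _ _ (leq_maxl i j))).
  by apply: (subsetPset _ _ (ndG _ _ (leq_maxr i j))).
move=> k; have [mF Fk] := Foo k; have [mG Gk] := Goo k; split.
  rewrite -[X in measurable X]setTI; apply: measurable_uncons_rV => //.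
  exact: measurableX.
rewrite /lebesgue_cons /pushforward -comp_preimage.
rewrite (_ : _ \o _ = id); last by apply/funext => p /=; rewrite cons_rVK.
by rewrite preimage_id product_measure1E// lte_mul_pinfty// ge0_fin_numE.
Qed.

HB.instance Definition _ := Measure_isSigmaFinite.Build _ _ _ lebesgue_cons
  lebesgue_cons_sigma_finite.

End cons_measure.

(* Lebesgue measure on R^n, as the n-fold product of the one on R. *)
Fixpoint lebesgue_rV n : {sigma_finite_measure set 'rV[R]_n -> \bar R} :=
  match n with
  | 0 => dirac (0 : 'rV[R]_0)
  | m.+1 => lebesgue_cons (lebesgue_rV m)
  end.

End lebesgue_rV.

Section euclidean.
Context {R : realType} {N : nat}.
Implicit Types (Omega : set 'rV[R]_N) (x : 'rV[R]_N).

(* The library norm on 'rV[R]_N is the max norm; it induces the same topology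
   and the same bounded sets. *)
Definition enorm x : R := Num.sqrt (\sum_(i < N) x ord0 i ^+ 2).

Definition domain Omega := [/\ Omega !=set0, open Omega & connected Omega].

Definition diam Omega : R :=
  sup [set enorm (z.1 - z.2) | z in Omega `*` Omega].

Definition volume Omega : R := fine (lebesgue_rV N Omega).

Definition mean Omega (u : 'rV[R]_N -> R) : R :=
  (volume Omega)^-1 * \int[lebesgue_rV N]_(x in Omega) u x.

(* Functions on Omega are represented by total functions; only the restriction
   [u \_ Omega], extended by 0, is used.  Measurable means Borel measurable:
   every Lebesgue class has a Borel representative. *)
Definition LnormOn Omega (p : \bar R) (u : 'rV[R]_N -> R) : \bar R :=
  Lnorm (lebesgue_rV N) p (EFin \o (u \_ Omega)).

Definition LfunOn Omega (p : \bar R) (u : 'rV[R]_N -> R) : Prop :=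
  u \_ Omega \in Lfun (lebesgue_rV N) p.

End euclidean.

Section sobolev.
Context {R : realType} {N : nat}.
Implicit Types (Omega : set 'rV[R]_N) (u phi : 'rV[R]_N -> R).
Implicit Types (g : 'rV[R]_N -> 'rV[R]_N).

Definition partial (i : 'I_N) u : 'rV[R]_N -> R :=
  fun x => 'D_(delta_mx ord0 i) u x.

Definition iter_partial (s : seq 'I_N) u : 'rV[R]_N -> R :=
  foldr partial u s.

Definition smooth u := forall s : seq 'I_N,
  continuous (iter_partial s u) /\
  forall i x, derivable (iter_partial s u) x (delta_mx ord0 i).

Definition tsupport u : set 'rV[R]_N := closure [set x | u x != 0].

(* C_c^infty(Omega) *)
Definition test_function Omega phi :=
  [/\ smooth phi, compact (tsupport phi) & tsupport phi `<=` Omega].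

Definition locally_integrable_on Omega u :=
  measurable_fun Omega u /\
  forall K, compact K -> K `<=` Omega ->
    (lebesgue_rV N).-integrable K (EFin \o u).

Definition weak_gradient Omega u g :=
  locally_integrable_on Omega u /\
  forall i, locally_integrable_on Omega (fun x => g x ord0 i) /\
    forall phi, test_function Omega phi ->
      \int[lebesgue_rV N]_(x in Omega) (u x * partial i phi x) =
      - \int[lebesgue_rV N]_(x in Omega) (g x ord0 i * phi x).

(* W^{1,q}(Omega) *)
Definition sobolev1 Omega (q : \bar R) : set ('rV[R]_N -> R) :=
  [set u | LfunOn Omega q u /\
    exists g, weak_gradient Omega u g /\
      forall i, LfunOn Omega q (fun x => g x ord0 i)].

End sobolev.

Section constant.
Context {R : realType} {N : nat}.
Implicit Types (Omega : set 'rV[R]_N).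

Definition difference_set Omega : set 'rV[R]_N :=
  \bigcup_(x in Omega) [set x - y | y in Omega].

(* For N > 1 the value of [enorm x `^ (1 - N%:R)] at the origin is 0 instead of
   +oo; this concerns a single, hence negligible, point. *)
Definition D_infty Omega (q : \bar R) : \bar R :=
  ((diam Omega ^+ N / (N%:R * volume Omega))%R%:E *
   LnormOn (difference_set Omega) (hoelder_conjugate q)
     (fun x => (enorm x `^ (1 - N%:R))%R))%E.

End constant.

(* Main.v *)
Require Import Defs.
From mathcomp Require Import all_boot all_order all_algebra.
From mathcomp Require Import all_classical all_reals all_analysis.
From mathcomp Require Import measurable_realfun ess_sup_inf ring lra.
Import Order.TTheory GRing.Theory Num.Theory.
Import numFieldNormedType.Exports.
Local Open Scope classical_set_scope.
Local Open Scope ring_scope.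

(** Fix a vector h. Testing the weak gradient against the translates
    [phi (. - t h)], 0 <= t <= 1, of a test function phi and integrating in t
    gives, for almost every x with x and x + h in Omega,
      u (x + h) - u x = \int_0^1 gradu (x + t h) . h dt,
    without any mollification of u. By Tonelli, for almost every x in Omega this
    holds for almost every h, so that
      |Omega| |u x - u_Omega| <=
        \int_Omega \int_0^1 |gradu (x + t (y - x))| |y - x| dt dy.
    The substitution z = x + t (y - x), for which |z - x| <= t d_Omega, turns the
    right-hand side into at most
      \int_Omega |gradu z| |z - x| \int_(|z - x| / d_Omega)^1 t^(- N - 1) dt dz
        <= d_Omega^N / N \int_Omega |gradu z| |z - x|^(1 - N) dz,
    and Hoelder's inequality concludes. No integrability of |x|^((1 - N) q') is
    needed, since everything takes place in the extended reals. *)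

Set Implicit Arguments.
Unset Strict Implicit.
Unset Printing Implicit Defensive.

(** The null set in the increment formula depends on h, whereas the estimate at x needs all
    endpoints y = x + h together. The formula is therefore weakened to an inequality whose
    right-hand side, [segment_majorant], is nonnegative, defined for every pair (x, h) and jointly
    measurable; this makes Tonelli applicable to the set of pairs where it fails. In the
    substitution, dy = t^(- N) dz and |y - x| = |z - x| / t, whence the exponent - N - 1. All test
    functions are products of one-variable bumps. Partial derivatives and translates of such
    products have the same form, so smoothness is checked on the line only, and indicators of open
    boxes are limits of such products. The set V enters only at the end: for x and z in Omega the
    argument x - z of the kernel lies in V. *)

(** * Affine substitutions on the real line *)

(** The right-hand side is a measure in A (a scaled pushforward), so uniqueness of Lebesgue measure
    leaves only half-open intervals to check. *)
Lemma lebesgue_measure_affine (R : realType) (c v : R) (A : set R) :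
  c != 0 -> measurable A ->
  lebesgue_measure A =
    (`|c|%:E * lebesgue_measure ((fun y => c * y + v)%R @^-1` A))%E.
Proof.
move=> c0 mA.
have mf : measurable_fun setT (fun y : R => c * y + v : measurableTypeR R).
  by apply: measurable_funD => //; exact: measurable_funM.
pose mu : {measure set (measurableTypeR R) -> \bar R} :=
  mscale (NngNum (normr_ge0 c))
    (pushforward lebesgue_measure (fun y : R => c * y + v : measurableTypeR R)).
suff -> : lebesgue_measure A = mu mf A by [].
apply: lebesgue_measure_unique => // _ [[a b] _ <-].
change (lebesgue_measure `]a, b] =
  (`|c|%:E * lebesgue_measure ((fun y => c * y + v)%R @^-1` `]a, b]))%E).
have [c_lt0|c_gt0|] := ltgtP c 0; last by move=> /eqP; rewrite (negbTE c0).
  (* A negative factor reverses the interval, so its preimage is closed on the left and open on the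
     right. *)
  rewrite (_ : _ @^-1` _ = `[(b - v) / c, (a - v) / c[%classic); last first.
    apply/seteqP; split => x /=; rewrite !in_itv/= ler_ndivrMr// ltr_ndivlMr//;
      rewrite lerBrDr ltrBlDr mulrC => /andP[-> ->]//.
  rewrite !lebesgue_measure_itv/= !lte_fin ltr_ndivlMr// divfK// ltrD2r.
  case: ifPn => ab; last by rewrite mule0.
  rewrite -!EFinB -EFinM ltr0_norm//; congr EFin; field.
  by [].
rewrite (_ : _ @^-1` _ = `](a - v) / c, (b - v) / c]%classic); last first.
  apply/seteqP; split => x /=; rewrite !in_itv/= ler_pdivlMr// ltr_pdivrMr//;
    rewrite lerBrDr ltrBlDr mulrC => /andP[-> ->]//.
rewrite !lebesgue_measure_itv/= !lte_fin ltr_pdivlMr// divfK// ltrD2r.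
case: ifPn => ab; last by rewrite mule0.
by rewrite -!EFinB -EFinM gtr0_norm//; congr EFin; field.
Qed.

Lemma ge0_integral_affine1 (R : realType) (c v : R) (f : R -> \bar R) :
  c != 0 -> measurable_fun setT f -> (forall x, (0 <= f x)%E) ->
  (\int[lebesgue_measure]_x f x =
   `|c|%:E * \int[lebesgue_measure]_x f (c * x + v)%R)%E.
Proof.
move=> c0 mf f0.
have mg : measurable_fun setT (fun y : measurableTypeR R => c * y + v : measurableTypeR R).
  by apply: measurable_funD => //; exact: measurable_funM.
pose mu : {measure set (measurableTypeR R) -> \bar R} :=
  mscale (NngNum (normr_ge0 c))
    (pushforward lebesgue_measure (fun y : R => c * y + v : measurableTypeR R)).
transitivity (\int[mu mg]_x f x)%E.
  by apply: eq_measure_integral => // A mA _; exact: lebesgue_measure_affine.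
rewrite ge0_integral_mscale//; congr (_ * _)%E.
by rewrite (ge0_integral_pushforward mg).
Qed.

(** * Lebesgue measure on row vectors *)

Section rV_space.
Context {R : realType}.

Lemma cons_rVE0 n (p : R * 'rV[R]_n) : cons_rV p ord0 ord0 = p.1.
Proof. by have /(congr1 fst) := cons_rVK p. Qed.

Lemma cons_rVES n (p : R * 'rV[R]_n) j :
  cons_rV p ord0 (lift ord0 j) = p.2 ord0 j.
Proof. by have /(congr1 (fun q : R * 'rV[R]_n => q.2 ord0 j)) := cons_rVK p; rewrite mxE. Qed.

Lemma rVS_eqP n (x y : 'rV[R]_n.+1) : x ord0 ord0 = y ord0 ord0 ->
  (forall j, x ord0 (lift ord0 j) = y ord0 (lift ord0 j)) -> x = y.
Proof.
by move=> xy0 xyS; apply/rowP => i; have [j ->|->] := unliftP ord0 i.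
Qed.

Lemma ge0_integral_rVS n (f : 'rV[R]_n.+1 -> \bar R) :
  measurable_fun setT f -> (forall x, (0 <= f x)%E) ->
  (\int[lebesgue_rV n.+1]_x f x =
   \int[lebesgue_measure]_a \int[lebesgue_rV n]_w f (cons_rV (a, w)))%E.
Proof.
move=> mf f0.
have mc : measurable_fun setT (@cons_rV R n : measurableTypeR R * 'rV[R]_n -> _).
  exact: measurable_cons_rV.
have := @ge0_integral_pushforward _ _ _ _ R _ mc (lebesgue_measure \x lebesgue_rV n)%E
  setT f measurableT mf (fun y _ => f0 y).
rewrite preimage_setT fubini_tonelli1//.
  exact: measurableT_comp.
by move=> p; exact: f0.
Qed.

Lemma measurable_rV_affine d (T : measurableType d) n (c : R) (v : 'rV[R]_n)
    (f : T -> 'rV[R]_n) : measurable_fun setT f ->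
  measurable_fun setT (fun x => c *: f x + v).
Proof.
move=> mf; apply: measurable_fun_coorP => i.
under eq_fun do rewrite !mxE.
apply: measurable_funD => //; apply: measurable_funM => //.
exact: measurableT_comp (@measurable_coor _ _ n i) mf.
Qed.

(** Each coordinate contributes one factor |c|: the first by the substitution on the line, the
    others by induction, with Tonelli separating them. Later uses are c = 1 (translations), c = -1
    (reflections) and c = t^-1 (contraction towards x). *)
Lemma ge0_integral_affine n (c : R) (v : 'rV[R]_n) (f : 'rV[R]_n -> \bar R) :
  c != 0 -> measurable_fun setT f -> (forall x, (0 <= f x)%E) ->
  (\int[lebesgue_rV n]_x f x =
   (`|c| ^+ n)%:E * \int[lebesgue_rV n]_x f (c *: x + v)%R)%E.
Proof.
move=> c0; elim: n v f => [|n IHn] v f mf f0.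
  rewrite expr0 mul1e; apply: eq_integral => x _.
  by congr f; apply/rowP => -[].
have mfc : measurable_fun setT (fun x : 'rV[R]_n.+1 => f (c *: x + v)).
  by apply: measurableT_comp => //; exact: measurable_rV_affine.
rewrite !ge0_integral_rVS//.
pose w := (uncons_rV v).2.
have cE a y : c *: cons_rV (a, y) + v =
    cons_rV (c * a + v ord0 ord0, c *: y + w).
  apply: rVS_eqP => [|j]; rewrite [LHS]mxE [X in X + _]mxE.
    by rewrite !cons_rVE0.
  by rewrite !cons_rVES/= !mxE.
have mc : measurable_fun setT (@cons_rV R n : measurableTypeR R * 'rV[R]_n -> _).
  exact: measurable_cons_rV.
have mF : measurable_fun setT (fun p : measurableTypeR R * 'rV[R]_n => f (cons_rV p)).
  exact: measurableT_comp.
rewrite (ge0_integral_affine1 (v ord0 ord0) c0); last 2 first.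
- exact: (measurable_fun_fubini_tonelli_F
    (fun p : measurableTypeR R * 'rV[R]_n => f (cons_rV p))).
- by move=> x; exact: integral_ge0.
rewrite exprS EFinM -muleA; congr (_ * _)%E.
rewrite -ge0_integralZl//; last 2 first.
- apply: (measurable_fun_fubini_tonelli_F
    (fun p : measurableTypeR R * 'rV[R]_n => f (c *: cons_rV p + v))) => //.
  exact: (measurableT_comp mfc mc).
- by move=> x _; exact: integral_ge0.
apply: eq_integral => a _; rewrite (IHn w)//; last first.
  exact: measurable_fun_pair2 mF.
by congr (_ * _)%E; apply: eq_integral => y _; rewrite cE.
Qed.

End rV_space.

(** * Boxes, and the measure of open and bounded sets *)

Section boxes.
Context {R : realType}.
Implicit Types n : nat.

Definition obox n (a b : 'rV[R]_n) : set 'rV[R]_n :=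
  [set x | forall i, a ord0 i < x ord0 i < b ord0 i].

Definition cbox n (a b : 'rV[R]_n) : set 'rV[R]_n :=
  [set x | forall i, a ord0 i <= x ord0 i <= b ord0 i].

Lemma measurable_rV_itv n (I : 'I_n -> interval R) :
  measurable [set x : 'rV[R]_n | forall i, x ord0 i \in I i].
Proof.
rewrite (_ : [set _ | _] =
    \bigcap_(i in [set: 'I_n]) ((fun x : 'rV[R]_n => x ord0 i) @^-1` [set` I i])).
  apply: fin_bigcap_measurable => // i _.
  by rewrite -[X in measurable X]setTI; exact: measurable_coor.
by apply/seteqP; split => x /=; [move=> xI i _; exact: xI|move=> xI i; exact: xI].
Qed.

Lemma measurable_obox n (a b : 'rV[R]_n) : measurable (obox a b).
Proof.
have := @measurable_rV_itv n (fun i => `]a ord0 i, b ord0 i[).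
by congr measurable; apply/seteqP; split => x /= xab i; have := xab i;
  rewrite in_itv.
Qed.

Lemma measurable_cbox n (a b : 'rV[R]_n) : measurable (cbox a b).
Proof.
have := @measurable_rV_itv n (fun i => `[a ord0 i, b ord0 i]).
by congr measurable; apply/seteqP; split => x /= xab i; have := xab i;
  rewrite in_itv.
Qed.

Lemma sub_obox_cbox n (a b : 'rV[R]_n) : obox a b `<=` cbox a b.
Proof. by move=> x xab i; have /andP[/ltW -> /ltW ->] := xab i. Qed.

Lemma lebesgue_cbox n (a b : 'rV[R]_n) :
  (forall i, a ord0 i <= b ord0 i) ->
  lebesgue_rV n (cbox a b) = (\prod_i (b ord0 i - a ord0 i))%:E.
Proof.
elim: n a b => [|n IHn] a b ab.
  by rewrite big_ord0 /= diracE mem_set// => -[].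
rewrite big_ord_recl EFinM.
pose ta := (uncons_rV a).2; pose tb := (uncons_rV b).2.
transitivity ((lebesgue_measure \x lebesgue_rV n)
    (`[a ord0 ord0, b ord0 ord0] `*` cbox ta tb))%E.
  congr (product_measure1 _ _ _); apply/seteqP; split => [p /= pab|p [/= p1 p2]].
    split => [/=|i].
      by have := pab ord0; rewrite cons_rVE0 in_itv.
    by have := pab (lift ord0 i); rewrite cons_rVES/= !mxE.
  move=> i; have [j ->|->] := unliftP ord0 i.
    by have := p2 j; rewrite cons_rVES/= !mxE.
  by move: p1; rewrite cons_rVE0 in_itv.
rewrite product_measure1E//; last exact: measurable_cbox.
congr (_ * _)%E; last first.
  rewrite IHn; first by congr EFin; apply: eq_bigr => i _; rewrite !mxE.
  by move=> i; rewrite !mxE.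
apply: (eq_trans (lebesgue_measure_itv _)); rewrite /= lte_fin -EFinB.
have := ab ord0; rewrite le_eqVlt => /predU1P[->|->//].
by rewrite ltxx subrr.
Qed.

(** Balls of the max norm are cubes. *)
Lemma open_rV_cube n (U : set 'rV[R]_n) x : open U -> U x ->
  exists2 e : R, 0 < e &
    forall y : 'rV[R]_n, (forall i, `|x ord0 i - y ord0 i| < e) -> U y.
Proof.
move=> oU Ux; have /nbhs_ballP[e /= e0 xeU] := open_nbhs_nbhs (conj oU Ux).
by exists e => // y xy; apply: xeU; split=> // i j; rewrite (ord1 i); exact: xy.
Qed.

(** Countability lets null sets found box by box be united. The closed box has to fit in U because
    it carries the support of a test function; the open box is where the conclusion is drawn. *)
Lemma rat_boxes n : exists a b : nat -> 'rV[R]_n,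
  forall (U : set 'rV[R]_n) x, open U -> U x ->
  exists k, cbox (a k) (b k) `<=` U /\ obox (a k) (b k) x.
Proof.
pose I := ('rV[rat]_n * 'rV[rat]_n)%type.
(* Enumerates all pairs of rational corners; an index that codes no pair gives the pair (0, 0). *)
pose p k : I := odflt (0, 0) (unpickle k).
exists (fun k => map_mx ratr (p k).1), (fun k => map_mx ratr (p k).2).
move=> U x oU Ux; have [e e0 xeU] := open_rV_cube oU Ux.
(* Corners within e / 2 of x keep the whole closed box in the open cube of radius e. *)
have h i : exists q : rat * rat, [/\ x ord0 i - e / 2 < ratr q.1,
    ratr q.1 < x ord0 i, x ord0 i < ratr q.2 & ratr q.2 < x ord0 i + e / 2].
  have [q1] := @rat_in_itvoo R (x ord0 i - e / 2) (x ord0 i) ltac:(lra).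
  have [q2] := @rat_in_itvoo R (x ord0 i) (x ord0 i + e / 2) ltac:(lra).
  by rewrite !in_itv/= => /andP[? ?] /andP[? ?]; exists (q1, q2).
have [q qP] := fin_all_exists h.
exists (pickle ((\row_i (q i).1, \row_i (q i).2) : I)).
rewrite /p pickleK/=; split=> [y yab|i]; last first.
  by have [_ ? ? _] := qP i; rewrite !mxE; apply/andP.
apply: xeU => i; have := yab i; rewrite !mxE => /andP[ay yb].
by have [? ? ? ?] := qP i; rewrite ltr_norml; apply/andP; split; lra.
Qed.

(** The sigma-algebra is generated by the coordinates, so an open set has to be written as a
    countable union of boxes. *)
Lemma open_measurable_rV n (U : set 'rV[R]_n) : open U -> measurable U.
Proof.
move=> oU; have [a [b abP]] := rat_boxes n.
rewrite (_ : U = \bigcup_(k in [set k | cbox (a k) (b k) `<=` U]) obox (a k) (b k)).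
  by apply: bigcup_measurable => k _; exact: measurable_obox.
apply/seteqP; split => [x Ux|x [k /= abU /sub_obox_cbox/abU//]].
by have [k [? ?]] := abP U x oU Ux; exists k.
Qed.

Lemma open_lebesgue_gt0 n (U : set 'rV[R]_n) :
  open U -> U !=set0 -> (0 < lebesgue_rV n U)%E.
Proof.
move=> oU [x Ux]; have [e e0 xeU] := open_rV_cube oU Ux.
pose a := \row_i (x ord0 i - e / 2); pose b := \row_i (x ord0 i + e / 2).
apply: (@lt_le_trans _ _ (lebesgue_rV n (cbox a b))).
  rewrite lebesgue_cbox => [|i]; last by rewrite !mxE; lra.
  by rewrite lte_fin; apply: prodr_gt0 => i _; rewrite !mxE; lra.
apply: le_measure; rewrite ?inE; [exact: measurable_cbox|exact: open_measurable_rV|].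
move=> y yab; apply: xeU => i; have := yab i; rewrite !mxE => /andP[? ?].
by rewrite ltr_norml; apply/andP; split; lra.
Qed.

Lemma bounded_sub_cbox n (A : set 'rV[R]_n) : bounded_set A ->
  exists2 M : R, 0 <= M & A `<=` cbox (const_mx (- M)) (const_mx M).
Proof.
move=> [M0 [_ M0A]]; pose M := Num.max 0 (M0 + 1).
exists M; first by rewrite le_max lexx.
have M0M : M0 < M by rewrite lt_max ltrDl ltr01 orbT.
move=> x Ax i; have := M0A M M0M x Ax => /= xM.
rewrite !mxE -ler_norml (le_trans _ xM)//.
rewrite [`|x|]mx_normrE; exact: (le_bigmax _ (fun i => `|x i.1 i.2|) (ord0, i)).
Qed.

Lemma bounded_lebesgue_lty n (A : set 'rV[R]_n) :
  bounded_set A -> measurable A -> (lebesgue_rV n A < +oo)%E.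
Proof.
move=> /bounded_sub_cbox[M M0 AM] mA.
apply: (@le_lt_trans _ _ (lebesgue_rV n (cbox (const_mx (- M)) (const_mx M)))).
  by apply: le_measure; rewrite ?inE//; exact: measurable_cbox.
by rewrite lebesgue_cbox ?ltry// => i; rewrite !mxE; lra.
Qed.

End boxes.

(** * Smooth bumps *)

Section smooth_bump.
Context {R : realType}.
Implicit Types (f g : R -> R) (n m : nat).

(** The derivative is existentially quantified so that closure under sums, products and affine
    substitution follows by induction on n from explicit derivatives. *)
Fixpoint Cn n f : Prop :=
  if n is n'.+1 then
    exists2 f' : R -> R, forall x : R, is_derive x 1 f (f' x) & Cn n' f'
  else continuous f.

Lemma is_derive_continuous f (f' : R -> R) :
  (forall x : R, is_derive x 1 f (f' x)) -> continuous f.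
Proof.
move=> ff' x; apply/differentiable_continuous/derivable1_diffP.
by case: (ff' x).
Qed.

Lemma CnW n f : Cn n.+1 f -> Cn n f.
Proof.
elim: n f => [|n IHn] f [f' ff' Cf']; first exact: is_derive_continuous ff'.
by exists f' => //; exact: IHn.
Qed.

Lemma CnD n f g : Cn n f -> Cn n g -> Cn n (f + g).
Proof.
elim: n f g => [|n IHn] f g.
  by move=> cf cg x; apply: cvgD; [exact: cf|exact: cg].
move=> [f' ff' Cf] [g' gg' Cg]; exists (f' + g'); last exact: IHn.
by move=> x; apply: is_deriveD.
Qed.

Lemma CnM n f g : Cn n f -> Cn n g -> Cn n (f * g).
Proof.
elim: n f g => [|n IHn] f g.
  by move=> cf cg x; apply: cvgM; [exact: cf|exact: cg].
move=> Cf Cg; case: (Cf) => f' ff' Cf'; case: (Cg) => g' gg' Cg'.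
exists (f * g' + g * f').
  by move=> x; apply: is_deriveM.
by apply: CnD; apply: IHn => //; exact: CnW.
Qed.

Lemma Cn_cst n (c : R) : Cn n (fun=> c).
Proof.
elim: n c => [|n IHn] c; first by move=> x; exact: cvg_cst.
by exists (fun=> 0) => // x; exact: is_derive_cst.
Qed.

Lemma Cn_affine n f (c d : R) : Cn n f -> Cn n (fun x => f (c * x + d)).
Proof.
elim: n f => [|n IHn] f.
  move=> cf x; apply: (@continuous_comp _ _ _ (fun x => c * x + d) f).
    by apply: cvgD; [apply: cvgMr; exact: cvg_id|exact: cvg_cst].
  exact: cf.
move=> [f' ff' Cf']; exists (fun x => f' (c * x + d) * c).
  move=> x; apply: (@is_derive1_comp R f (fun x => c * x + d)).
  rewrite (_ : (fun x => c * x + d) = (cst c * id + cst d))//.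
  by apply: is_derive_eq; rewrite /= addr0 scaler0 addr0 -[_ *: _]/(_ * _) mulr1.
by apply: (CnM (g := fun=> c)); [exact: IHn|exact: Cn_cst].
Qed.

(* The family [flat] is closed under differentiation up to linear combinations:
   flat m' = flat (m + 2) - m flat (m + 1). *)
Definition flat m (x : R) : R :=
  if x <= 0 then 0 else x^-1 ^+ m * expR (- x^-1).

(** Comes from exp(1/x) >= (1/x)^(m+2) / (m+2)!. The power 2 of x is chosen so that the difference
    quotient at 0 is still O(x). *)
Lemma flat_bound m (x : R) : 0 <= flat m x <= (m.+2)`!%:R * x ^+ 2.
Proof.
rewrite /flat; case: ifPn => [_|].
  by rewrite lexx mulr_ge0// sqr_ge0.
rewrite -ltNge => x0; have x1 : 0 <= x^-1 by rewrite invr_ge0 ltW.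
rewrite mulr_ge0 ?expR_ge0 ?exprn_ge0//=.
rewrite expRN ler_pdivrMr ?expR_gt0//.
have := expR_ge1Dxn m.+1 x1 => h.
have {}h : x^-1 ^+ m.+2 / (m.+2)`!%:R <= expR x^-1.
  by apply: le_trans h; rewrite lerDr.
have F0 : 0 < (m.+2)`!%:R :> R by rewrite ltr0n fact_gt0.
rewrite ler_pdivrMr// in h.
have -> : x^-1 ^+ m = x ^+ 2 * x^-1 ^+ m.+2.
  by rewrite -[m.+2]/(2 + m)%N exprD mulrA -exprMn divff ?gt_eqF// expr1n mul1r.
rewrite [leRHS](_ : _ = x ^+ 2 * (expR x^-1 * (m.+2)`!%:R)); last by ring.
by rewrite ler_wpM2l// sqr_ge0.
Qed.

Lemma is_derive_flat_pos m (x : R) : 0 < x ->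
  is_derive x 1 (flat m) (flat m.+2 x - m%:R * flat m.+1 x).
Proof.
move=> x0.
have dV : is_derive x 1 (fun y : R => y^-1) (- x ^- 2).
  have := @is_deriveV R id x 1 1; rewrite -[_ *: _]/(_ * _) mulr1; apply.
  by rewrite gt_eqF.
have dX := @is_deriveX R R (fun y => y^-1) m x 1 _ dV.
have dE : is_derive x 1 (fun y : R => expR (- y^-1)) (expR (- x^-1) * x ^- 2).
  apply: (@is_derive1_comp R expR (fun y => - y^-1)).
  by have := @is_deriveN R R R (fun y => y^-1) x 1 _ dV; rewrite opprK.
have dM := is_deriveM dX dE.
apply: (near_eq_is_derive (f := (fun y : R => y^-1) ^+ m * (fun y : R => expR (- y^-1)))).
  near=> y.
  have y0 : 0 < y by near: y; exact: lt_nbhsr.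
  by rewrite /flat leNgt y0/=; rewrite exprfctE.
apply: is_derive_eq.
rewrite /flat leNgt x0/= -[_ *: _]/(_ * _) -[X in _ + X]/(_ * _) exprfctE.
rewrite -[(_ * _) *: _]/(_ * _ * _) -!exprVn.
case: m dX dM => [|m] _ _; first by rewrite !expr0 mulr0n !mul0r; ring.
rewrite /= !exprS; ring.
Unshelve. all: by end_near. Qed.

Lemma flat_le0 m (x : R) : x <= 0 -> flat m x = 0.
Proof. by rewrite /flat => ->. Qed.

(** Away from 0 this is local calculus. At 0 the quadratic bound of [flat_bound] forces the
    difference quotient to 0, which is the value of the formula there. *)
Lemma is_derive_flat m (x : R) :
  is_derive x 1 (flat m) (flat m.+2 x - m%:R * flat m.+1 x).
Proof.
have [x0|x0|->] := ltgtP x 0; last 2 first.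
- exact: is_derive_flat_pos.
- rewrite !flat_le0// mulr0 subr0.
  suff h : (fun h : R => h^-1 *: (flat m (h *: 1 + 0) - flat m 0)) h @[h --> 0^'] --> 0.
    by split; [apply/cvg_ex; exists 0|exact/cvg_lim].
  apply/cvgr0Pnorm_le => e e0; near=> h.
  have h0 : h != 0 by near: h; exact: nbhs_dnbhs_neq.
  rewrite addr0 (flat_le0 _ (lexx 0)) subr0 -[_ *: 1]/(_ * _) mulr1 normrM normfV.
  rewrite ler_pdivrMl ?normr_gt0//.
  have /andP[f0 fb] := flat_bound m h.
  rewrite ger0_norm// (le_trans fb)// -(real_normK (num_real h)) expr2 mulrCA.
  rewrite ler_wpM2l// -ler_pdivlMl ?ltr0n ?fact_gt0//.
  near: h; apply: dnbhs0_le; rewrite mulr_gt0// invr_gt0 ltr0n fact_gt0//.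
rewrite !flat_le0 ?ltW// mulr0 subr0.
apply: (near_eq_is_derive (f := cst 0)).
near=> y; rewrite flat_le0// ltW//; near: y; exact: lt_nbhsl.
Unshelve. all: by end_near. Qed.

Lemma Cn_flat n m : Cn n (flat m).
Proof.
elim: n m => [|n IHn] m; first exact: is_derive_continuous (is_derive_flat m).
exists (flat m.+2 + (fun=> - m%:R) * flat m.+1).
  move=> x; apply: is_derive_eq (is_derive_flat m x) _.
  by rewrite !fctE mulNr.
by apply: CnD => //; apply: CnM => //; exact: Cn_cst.
Qed.

(* For k going to infinity, these bumps increase to the indicator of ]a, b[. *)
Definition bump (k : nat) (a b x : R) : R :=
  flat 0 (k.+1%:R * (x - a)) * flat 0 (k.+1%:R * (b - x)).

Lemma Cn_bump n k a b : Cn n (bump k a b).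
Proof.
rewrite (_ : bump k a b = (fun x => flat 0 (k.+1%:R * x + - (k.+1%:R * a))) *
    (fun x => flat 0 (- k.+1%:R * x + k.+1%:R * b))).
  by apply: CnM; exact/Cn_affine/Cn_flat.
apply/funext => x; rewrite /bump !fctE; congr (flat 0 _ * flat 0 _); ring.
Qed.

Lemma bump_out k a b x : ~~ (a < x < b) -> bump k a b x = 0.
Proof.
rewrite negb_and -!leNgt => /orP[xa|bx]; rewrite /bump.
  by rewrite flat_le0 ?mul0r// pmulr_rle0 ?subr_le0.
by rewrite mulrC flat_le0 ?mul0r// pmulr_rle0 ?subr_le0.
Qed.

Lemma flat0_itv x : 0 <= flat 0 x <= 1.
Proof.
rewrite /flat; case: ifPn => [_|]; first by rewrite lexx ler01.
rewrite -ltNge => x0; rewrite mul1r expR_ge0/= -[leRHS]expR0 ler_expR.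
by rewrite oppr_le0 invr_ge0 ltW.
Qed.

Lemma bump_itv k a b x : 0 <= bump k a b x <= 1.
Proof.
have /andP[? ?] := flat0_itv (k.+1%:R * (x - a)).
have /andP[? ?] := flat0_itv (k.+1%:R * (b - x)).
by rewrite /bump mulr_ge0//= mulr_ile1.
Qed.

Lemma cvg_flat0 x : 0 < x -> flat 0 (k.+1%:R * x) @[k --> \oo] --> (1 : R).
Proof.
move=> x0.
rewrite (_ : (fun _ => _) = (fun k : nat => expR (- x^-1 * k.+1%:R^-1))).
  rewrite -[X in _ --> X]expR0; apply: continuous_cvg; first exact: continuous_expR.
  rewrite -[X in _ --> X](mulr0 (- x^-1)); apply: cvgMr; exact: cvg_harmonic.
apply/funext => k; rewrite /flat leNgt mulr_gt0//= expr0 mul1r invfM.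
by rewrite mulNr mulrC.
Qed.

Lemma cvg_bump a b x : a < x < b -> bump k a b x @[k --> \oo] --> (1 : R).
Proof.
move=> /andP[ax xb]; rewrite -[X in _ --> X](mulr1 1).
by apply: cvgM; apply: cvg_flat0; rewrite subr_gt0.
Qed.

End smooth_bump.

(** * Test functions of product form *)

Section product_functions.
Context {R : realType}.

(** Both difference quotients are the same function of the increment; directional derivatives thus
    become one-variable ones. *)
Lemma is_derive_line n (F : 'rV[R]_n -> R) (x v : 'rV[R]_n) (t dF : R) :
  is_derive t 1 (fun s : R => F (x + s *: v)) dF <-> is_derive (x + t *: v) v F dF.
Proof.
have E : (fun h : R => h^-1 *: (((fun s : R => F (x + s *: v)) \o shift t) (h *: 1)
    - F (x + t *: v))) =
  (fun h : R => h^-1 *: ((F \o shift (x + t *: v)) (h *: v) - F (x + t *: v))).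
  apply/funext => h /=; congr (_ *: (F _ - _)).
  by rewrite -[h *: 1]/(h * 1) mulr1 scalerDl addrCA.
by split=> -[h1 h2]; split; move: h1 h2; rewrite /derivable /derive E.
Qed.

(** The interval is closed so that its complement is open: vanishing there then passes to
    [derive1 f]. *)
Definition bump_on (a b : R) (f : R -> R) :=
  (forall n, Cn n f) /\ forall x, ~~ (a <= x <= b) -> f x = 0.

Lemma bump_on_is_derive a b f (x : R) : bump_on a b f -> is_derive x 1 f (derive1 f x).
Proof. 
move=> [/(_ 1)[f' ff' _] _]; rewrite derive1E.
by have -> : 'D_1 f x = f' x by exact: derive_val.
Qed.

Lemma bump_on_derive1 a b f : bump_on a b f -> bump_on a b (derive1 f).
Proof.
move=> Df; split=> [n|x xab].
  have [/(_ n.+1)[f' ff' Cf'] _] := Df.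
  rewrite (_ : derive1 f = f')//; apply/funext => x; rewrite derive1E.
  exact: derive_val.
rewrite derive1E; apply: derive_val.
apply: (near_eq_is_derive (f := cst 0)).
have [_ f0] := Df.
move: xab; rewrite negb_and -!ltNge => /orP[xa|bx].
  near=> y; rewrite f0// negb_and -!ltNge.
  by apply/orP; left; near: y; exact: lt_nbhsl.
near=> y; rewrite f0// negb_and -!ltNge.
by apply/orP; right; near: y; exact: lt_nbhsr.
Unshelve. all: by end_near. Qed.

Lemma bump_on_continuous a b f : bump_on a b f -> continuous f.
Proof. by move=> [/(_ 0)]. Qed.

Lemma bump_on_bounded a b f : bump_on a b f -> exists C, forall x, `|f x| <= C.
Proof.
move=> Df; have cf := bump_on_continuous Df; have [_ f0] := Df.
have [ba|ab] := ltP b a.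
  exists 0 => x; rewrite f0 ?normr0// negb_and -!ltNge.
  by have [//|ax] := ltP x a; rewrite (lt_le_trans ba ax).
have cnf : {within `[a, b], continuous (fun x => `|f x|)}.
  apply: continuous_subspaceT => x.
  by apply: (@continuous_comp _ _ _ f Num.norm); [exact: cf|exact: norm_continuous].
have [c _ cP] := EVT_max ab cnf.
exists `|f c| => x.
have [xab|/f0 ->] := boolP (a <= x <= b); last by rewrite normr0.
by apply: cP; rewrite in_itv.
Qed.

Variable n : nat.
Implicit Types (f : 'I_n -> R -> R) (a b : 'rV[R]_n).

Definition prodf f (x : 'rV[R]_n) : R := \prod_i f i (x ord0 i).

Definition bumps_on a b f := forall i, bump_on (a ord0 i) (b ord0 i) (f i).

(** The factors of the i-th partial derivative: only one factor changes, so all iterated partial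
    derivatives are again product functions. *)
Definition diff_at f (i : 'I_n) := fun j => if j == i then derive1 (f j) else f j.

Lemma bumps_on_diff_at a b f i : bumps_on a b f -> bumps_on a b (diff_at f i).
Proof.
move=> Df j; rewrite /diff_at; case: ifP => _; last exact: Df.
exact/bump_on_derive1/Df.
Qed.

Lemma is_derive_prodf a b f i (x : 'rV[R]_n) : bumps_on a b f ->
  is_derive x (delta_mx ord0 i) (prodf f) (prodf (diff_at f i) x).
Proof.
move=> Df; pose c := \prod_(j | j != i) f j (x ord0 j).
have dfi := @bump_on_is_derive _ _ (f i) (x ord0 i) (Df i).
rewrite -[x in is_derive x](addr0 x) -(scale0r (delta_mx ord0 i)).
apply/is_derive_line.
have xE (s : R) j : (x + s *: delta_mx ord0 i) ord0 j =
    if j == i then x ord0 i + s else x ord0 j.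
  rewrite !mxE eqxx/=; case: eqVneq => [->|_]; first by rewrite mulr1.
  by rewrite mulr0 addr0.
rewrite (_ : (fun s => _) = (fun s : R => c * f i (s + x ord0 i))); last first.
  apply/funext => s; rewrite /prodf (bigD1 i)//= mulrC; congr (_ * f i _).
    by apply: eq_bigr => j ji; congr (f j _); rewrite (xE s j) (negbTE ji).
  by apply: (eq_trans (xE s i)); rewrite eqxx addrC.
have -> : prodf (diff_at f i) x = c * derive1 (f i) (x ord0 i).
  rewrite /prodf (bigD1 i)//= mulrC /diff_at eqxx; congr (_ * _).
  by apply: eq_bigr => j /negbTE ->.
have d1 : is_derive (0 : R) 1 (fun s => f i (s + x ord0 i)) (derive1 (f i) (x ord0 i)).
  rewrite -[X in is_derive _ _ _ X]mulr1.
  apply: (@is_derive1_comp R (f i) (fun s => s + x ord0 i)).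
    by rewrite add0r.
  by apply: is_derive_eq; rewrite addr0.
have := is_deriveZ c d1.
by [].
Qed.

(** Partial derivatives alone do not control oblique directions. Full differentiability makes the
    derivative linear in the direction, as required along segments. *)
Lemma differentiable_prodf a b f (x : 'rV[R]_n) : bumps_on a b f ->
  differentiable (prodf f) x.
Proof.
move=> Df.
rewrite (_ : prodf f = \prod_(i < n) (fun x : 'rV[R]_n => f i (x ord0 i))); last first.
  by apply/funext => y; rewrite fct_prodE.
elim/big_ind: _ => [|g h dg dh|i _].
- exact: (@differentiable_cst _ _ _ (1 : R)).
- exact: differentiableM.
- apply: (@differentiable_comp _ _ _ _ (fun x : 'rV[R]_n => x ord0 i) (f i)).
    exact: differentiable_coord.
  by apply/derivable1_diffP; case: (bump_on_is_derive (x ord0 i) (Df i)).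
Qed.

Lemma continuous_prodf a b f : bumps_on a b f -> continuous (prodf f).
Proof.
by move=> Df x; apply: differentiable_continuous; exact: differentiable_prodf Df.
Qed.

Lemma iter_partial_prodf a b f (s : seq 'I_n) : bumps_on a b f ->
  exists2 g, bumps_on a b g & iter_partial s (prodf f) = prodf g.
Proof.
move=> Df; elim: s => [|i s [g Dg IHs]]; first by exists f.
exists (diff_at g i); first exact: bumps_on_diff_at.
rewrite /= IHs; apply/funext => x; apply: derive_val.
exact: is_derive_prodf Dg.
Qed.

Lemma prodf_out a b f x : bumps_on a b f -> ~ cbox a b x -> prodf f x = 0.
Proof.
move=> Df /existsNP[i xi]; rewrite /prodf (bigD1 i)//=.
by have [_ ->] := Df i; rewrite ?mul0r//; exact/negP.
Qed.

Lemma closed_cbox a b : closed (cbox a b).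
Proof.
rewrite (_ : cbox a b = \bigcap_(i in [set: 'I_n])
    (fun x : 'rV[R]_n => x ord0 i) @^-1` `[a ord0 i, b ord0 i]).
  apply: closed_bigI => i _; apply: closed_comp => [x _|].
    exact: coord_continuous.
  exact: interval_closed.
by apply/seteqP; split => x /=; [move=> xI i _; rewrite /= in_itv; exact: xI
  |move=> xI i; have := xI i I; rewrite /= in_itv].
Qed.

Lemma bounded_cbox a b : bounded_set (cbox a b).
Proof.
exists (\sum_i (`|a ord0 i| + `|b ord0 i|)); split; first exact: num_real.
move=> M hM x /= xab; rewrite [`|x|]mx_normrE; apply/bigmax_leP; split.
  by apply: ltW; apply: le_lt_trans hM; apply: sumr_ge0 => i _; rewrite addr_ge0.
move=> -[i j] _ /=; rewrite (ord1 i); apply: ltW; apply: le_lt_trans hM.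
rewrite (bigD1 j)//= -[leLHS]addr0 lerD//; last first.
  by apply: sumr_ge0 => k _; rewrite addr_ge0.
have /andP[h1 h2] := xab j; rewrite ler_norml.
have := ler_norm (- a ord0 j); have := ler_norm (b ord0 j); rewrite normrN.
have := normr_ge0 (a ord0 j); have := normr_ge0 (b ord0 j).
by move=> ? ? ? ?; apply/andP; split; lra.
Qed.

Lemma prodf_test_function (Omega : set 'rV[R]_n) a b f :
  bumps_on a b f -> cbox a b `<=` Omega -> test_function Omega (prodf f).
Proof.
move=> Df abO.
have tab : tsupport (prodf f) `<=` cbox a b.
  rewrite [X in _ `<=` X]((closure_id _).1 (@closed_cbox a b)).
  apply: closure_subset => x /= fx0; apply: contrapT => /(prodf_out Df) fx.
  by rewrite fx eqxx in fx0.
split; last exact: subset_trans abO.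
- move=> s; have [g Dg ->] := iter_partial_prodf s Df; split.
    exact: continuous_prodf Dg.
  by move=> i x; case: (is_derive_prodf i x Dg).
- apply: (@subclosed_compact _ _ (cbox a b)) => //; first exact: closed_closure.
  by apply: bounded_closed_compact; [exact: bounded_cbox|exact: closed_cbox].
Qed.

Lemma partial_prodf a b f i : bumps_on a b f ->
  partial i (prodf f) = prodf (diff_at f i).
Proof.
by move=> Df; apply/funext => x; apply: derive_val; exact: is_derive_prodf Df.
Qed.

Lemma is_derive_prodf_line a b f (x v : 'rV[R]_n) (t : R) : bumps_on a b f ->
  is_derive t 1 (fun s : R => prodf f (x + s *: v))
    (\sum_i v ord0 i * prodf (diff_at f i) (x + t *: v)).
Proof.
move=> Df; apply/is_derive_line; move: (x + t *: v) => y.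
have df := differentiable_prodf y Df.
apply: DeriveDef; first exact: diff_derivable.
rewrite deriveE// [in LHS](row_sum_delta v) linear_sum/=.
apply: eq_bigr => i _; rewrite linearZ/= -deriveE//.
by congr (_ * _); apply: derive_val; exact: is_derive_prodf Df.
Qed.

Lemma prodf_bounded a b f : bumps_on a b f -> exists C, forall x, `|prodf f x| <= C.
Proof.
move=> Df; have [C CP] := fin_all_exists (fun i => bump_on_bounded (Df i)).
exists (\prod_i C i) => x; rewrite /prodf normr_prod.
by apply: ler_prod => i _; rewrite normr_ge0 CP.
Qed.

Lemma measurable_prodf a b f : bumps_on a b f -> measurable_fun setT (prodf f).
Proof.
move=> Df; apply: measurable_prod => i _.
apply: measurableT_comp; last exact: measurable_coor.
exact: continuous_measurable_fun (bump_on_continuous (Df i)).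
Qed.

End product_functions.

(** * Fundamental lemma of the calculus of variations *)

Section variations.
Context {R : realType} {n : nat}.
Local Notation mu := (@lebesgue_rV R n).
Implicit Types (a b : 'rV[R]_n).

Definition oboxes : set (set 'rV[R]_n) := [set A | exists a b, A = obox a b].

Lemma oboxI a b a' b' : obox a b `&` obox a' b' =
  obox (\row_i Num.max (a ord0 i) (a' ord0 i)) (\row_i Num.min (b ord0 i) (b' ord0 i)).
Proof.
apply/seteqP; split => [x [xab xab'] i|x xab].
  by have /andP[h1 h2] := xab i; have /andP[h3 h4] := xab' i;
    rewrite !mxE gt_max lt_min h1 h2 h3 h4.
by split=> i; have := xab i; rewrite !mxE gt_max lt_min => /andP[/andP[h1 h2] /andP[h3 h4]];
  apply/andP.
Qed.

Lemma rV_bound (x : 'rV[R]_n) : exists k : nat, forall i, - k%:R < x ord0 i < k%:R.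
Proof.
exists (Num.truncn (\sum_i `|x ord0 i|)).+1 => i.
rewrite -ltr_norml; apply: le_lt_trans (truncnS_gt _).
by rewrite (bigD1 i)//= lerDl sumr_ge0.
Qed.

(** The half-spaces on which one coordinate exceeds c generate the sigma-algebra, and each is a
    countable union of open boxes. *)
Lemma measurable_rV_oboxes : @measurable _ 'rV[R]_n = <<s oboxes >>.
Proof.
apply/seteqP; split; last first.
  apply: smallest_sub; first exact: sigma_algebra_measurable.
  by move=> _ [a [b ->]]; exact: measurable_obox.
apply: smallest_sub; first exact: smallest_sigma_algebra.
move=> A; rewrite -bigcup_seq/= => -[i _ [B mB <-]].
suff : measurable_fun setT
    (fun x : g_sigma_algebraType oboxes => (x : 'rV[R]_n) ord0 i).
  by move=> /(_ measurableT _ mB).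
apply: (measurability _ (RGenOInfty.measurableE R)) => _ [_ [c ->] <-].
rewrite setTI.
pose a k : 'rV[R]_n := \row_j if j == i then c else - k%:R.
pose b k : 'rV[R]_n := const_mx k%:R.
rewrite (_ : _ @^-1` _ = \bigcup_k obox (a k) (b k)).
  apply: bigcupT_measurable => k; apply: sub_sigma_algebra.
  by exists (a k), (b k).
apply/seteqP; split => [x /=|x [k _ xab] /=]; rewrite in_itv/= andbT.
  move=> cx; have [k xk] := rV_bound x; exists k => // j; rewrite !mxE.
  by have /andP[h1 ->] := xk j; case: eqVneq => [->|_]; rewrite ?cx ?h1.
by have := xab i; rewrite !mxE eqxx => /andP[].
Qed.

(** The sets over which v integrates to 0 form a Dynkin system: the total integral gives
    complements, integrability gives disjoint countable unions. Boxes are stable under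
    intersection. *)
Lemma integral0_obox (v : 'rV[R]_n -> \bar R) : mu.-integrable setT v ->
  (forall a b, \int[mu]_(x in obox a b) v x = 0)%E ->
  (\int[mu]_x v x = 0)%E ->
  forall E, measurable E -> (\int[mu]_(x in E) v x = 0)%E.
Proof.
move=> iv vab vT E; rewrite measurable_rV_oboxes.
apply: (dynkin_induction (P := fun E => \int[mu]_(x in E) v x = 0)%E) => //.
- exact: measurable_rV_oboxes.
- by move=> _ _ [a [b ->]] [a' [b' ->]]; rewrite oboxI; do 2 eexists.
- by move=> _ [a [b ->]]; exact: vab.
- move=> A mA A0; have := vT; rewrite -(setUv A) integral_setU//.
  + by rewrite A0 add0e.
  + exact: measurableC.
  + by rewrite setUv; exact: measurable_int iv.
  + by apply/disj_setPS => x [].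
- move=> F mF tF F0; rewrite integral_bigcup//.
    by rewrite eseries0// => k _ _; exact: F0.
  apply: integrableS iv => //; exact: bigcupT_measurable.
Qed.

Definition pbump (k : nat) a b : 'rV[R]_n -> R :=
  prodf (fun i => bump k (a ord0 i) (b ord0 i)).

Lemma bumps_on_bump k a b :
  bumps_on a b (fun i => bump k (a ord0 i) (b ord0 i)).
Proof.
move=> i; split=> [m|x]; first exact: Cn_bump.
by move=> xab; apply: bump_out; apply: contra xab => /andP[/ltW -> /ltW ->].
Qed.

Lemma pbump_itv k a b x : 0 <= pbump k a b x <= 1.
Proof.
rewrite /pbump /prodf; apply/andP; split.
  by apply: prodr_ge0 => i _; have /andP[] := bump_itv k (a ord0 i) (b ord0 i) (x ord0 i).
by apply: prodr_ile1 => i _; exact: bump_itv.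
Qed.

Lemma cvg_pbump a b x :
  (fun k => pbump k a b x) @ \oo --> (\1_(obox a b) x : R).
Proof.
rewrite indicE; have [xab|xab] := boolP (x \in obox a b).
  rewrite inE in xab.
  rewrite (_ : (true : nat)%:R = \prod_(i < n) (1 : R)); last by rewrite big1.
  rewrite (_ : (fun k => pbump k a b x) =
      \prod_(i < n) (fun k => bump k (a ord0 i) (b ord0 i) (x ord0 i))).
    apply: (big_ind2 (fun (f : R^nat) l => f @ \oo --> l)).
    - exact: (@cvg_cst _ (1 : R)).
    - by move=> f l g m fl gm; exact: cvgM.
    - by move=> i _; exact: cvg_bump.
  by apply/funext => k; rewrite fct_prodE.
rewrite (_ : (fun _ => _) = cst 0); first exact: cvg_cst.
apply/funext => k; rewrite /pbump /prodf.
move: xab; rewrite notin_setE => /existsNP[i xi].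
by rewrite (bigD1 i)//= bump_out ?mul0r//; exact/negP.
Qed.

(* Test functions of product form suffice since boxes form a pi-system
   generating the Borel sets. *)
Lemma ae_eq0_pbump (U : set 'rV[R]_n) (w : 'rV[R]_n -> R) : open U ->
  mu.-integrable setT (EFin \o w) ->
  (forall k a b, cbox a b `<=` U ->
    (\int[mu]_x (w x * pbump k a b x)%:E = 0)%E) ->
  {ae mu, forall x, U x -> w x = 0}.
Proof.
move=> oU iw wU.
have mw : measurable_fun setT w by apply/measurable_EFinP; exact: measurable_int iw.
have wab a b : cbox a b `<=` U -> (\int[mu]_(x in obox a b) (w x)%:E = 0)%E.
  move=> abU; rewrite integral_mkcond.
  have [|||||_ _] := @dominated_convergence _ _ R mu setT measurableT
    (fun k x => (w x * pbump k a b x)%:E) (fun x => (w x * \1_(obox a b) x)%:E)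
    (* The bumps have values in [0, 1], so |w| dominates. *)
    (fun x => `|(w x)%:E|%E).
  - move=> k; apply/measurable_EFinP/measurable_funM => //.
    exact: measurable_prodf (bumps_on_bump k a b).
  - apply/measurable_EFinP/measurable_funM => //.
    by apply: measurable_indic; exact: measurable_obox.
  - apply/aeW => x _; apply: cvg_EFin; first by exact: nearW.
    by apply: cvgMr; exact: cvg_pbump.
  - exact: integrable_abse.
  - apply/aeW => x k _ /=; rewrite lee_fin normrM ler_piMr//.
    by have /andP[p0 p1] := pbump_itv k a b x; rewrite ger0_norm.
  rewrite (_ : [sequence _]_k = cst 0%E); last by apply/funext => k; exact: wU.
  move/cvg_lim; rewrite lim_cst// => /(_ (@ereal_hausdorff R)) ->.
  apply: eq_integral => x _; rewrite patchE indicE.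
  by case: ifPn => _; rewrite ?mulr1 ?mulr0.
have [a [b abP]] := @rat_boxes R n.
suff : {ae mu, forall x k, cbox (a k) (b k) `<=` U -> obox (a k) (b k) x -> w x = 0}.
  apply: filterS => x wx Ux; have [k [kU kx]] := abP U x oU Ux; exact: wx kx.
apply: ae_foralln => k; have [abU|abU] := pselect (cbox (a k) (b k) `<=` U); last first.
  by apply/aeW => x /abU.
pose Q := obox (a k) (b k).
have mQ : measurable Q := measurable_obox (a k) (b k).
(* [wab] only covers boxes whose closed version lies in U. After cutting w down to Q, every box
   counts only through its intersection with Q, which is such a box. *)
pose v := (EFin \o w) \_ Q.
have iv : mu.-integrable setT v.
  by apply/(integrable_mkcond _ mQ).1; exact: integrableS iw.
have v0 := @integral0_obox v iv _ _.
suff : ae_eq mu setT v (cst 0%E).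
  apply: filterS => x /= vx0 _ Qx; have := vx0 I.
  by rewrite /v patchE mem_set// => -[].
apply: integral_ae_eq => // E _ mE; rewrite integral0; apply: v0 => //.
- move=> a' b'; rewrite -integral_mkcondr oboxI; apply: wab.
  apply: subset_trans abU => x xab i; have := xab i; rewrite !mxE.
  by rewrite ge_max le_min => /andP[/andP[_ ->] /andP[_ ->]].
- by rewrite -integral_mkcond; exact: wab.
Qed.

End variations.

(** * Translations and Fubini for integrals along segments *)

Section integration_tools.
Context {R : realType}.

Lemma integrable_mul_bounded d (T : measurableType d)
    (mu : {measure set T -> \bar R}) (f phi : T -> R) (C : R) :
  mu.-integrable setT (EFin \o f) -> measurable_fun setT phi ->
  (forall x, `|phi x| <= C) ->
  mu.-integrable setT (fun x => (f x * phi x)%:E).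
Proof.
move=> fi mphi phiC.
have mf : measurable_fun setT f by apply/measurable_EFinP; exact: measurable_int fi.
apply: (@le_integrable _ _ _ mu setT measurableT _ (fun x => C%:E * (f x)%:E)%E).
- by apply/measurable_EFinP; exact: measurable_funM.
- move=> x _; rewrite lee_fin !normrM mulrC ler_wpM2r//.
  by rewrite (le_trans (phiC x)) ?ler_norm.
- exact: integrableZl.
Qed.

Lemma FTC_01 (phi dphi : R -> R) : (forall t : R, is_derive t 1 phi (dphi t)) ->
  continuous dphi ->
  (\int[lebesgue_measure]_(t in `[0%R, 1%R]) (dphi t)%:E = (phi 1 - phi 0)%:E)%E.
Proof.
move=> dP dc; have phic := is_derive_continuous dP.
rewrite EFinB; apply: continuous_FTC2 => //.
- exact: continuous_subspaceT.
- split => [x _| |].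
  + by case: (dP x).
  + exact: cvg_at_right_filter (phic _).
  + exact: cvg_at_left_filter (phic _).
- by move=> x _; rewrite derive1E; exact: derive_val.
Qed.

Variable n : nat.
Local Notation mu := (@lebesgue_rV R n).

Lemma measurable_rV_line d (T : measurableType d) (f g : T -> 'rV[R]_n) (c : T -> R) :
  measurable_fun setT f -> measurable_fun setT c -> measurable_fun setT g ->
  measurable_fun setT (fun x => f x + c x *: g x).
Proof.
move=> mf mc mg; apply: measurable_fun_coorP => i.
under eq_fun do rewrite !mxE.
apply: measurable_funD; first exact: measurableT_comp (@measurable_coor _ _ n i) mf.
apply: measurable_funM => //; exact: measurableT_comp (@measurable_coor _ _ n i) mg.
Qed.

Lemma measurable_translate (v : 'rV[R]_n) : measurable_fun setT (fun x : 'rV[R]_n => x + v).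
Proof.
rewrite (_ : (fun x => _) = (fun x : 'rV[R]_n => x + 1 *: v)).
  exact: measurable_rV_line.
by apply/funext => x; rewrite scale1r.
Qed.

Lemma continuous_translate (h : 'rV[R]_n) :
  continuous (fun x : 'rV[R]_n => x + h).
Proof.
move=> x; apply: (@cvgD _ _ _ (nbhs x) _ id (cst h) x h).
  exact: cvg_id.
exact: cvg_cst.
Qed.

Lemma open_translate (h : 'rV[R]_n) (A : set 'rV[R]_n) :
  open A -> open [set x | A (x + h)].
Proof.
move=> oA.
have -> : [set x | A (x + h)] = ((fun x : 'rV[R]_n => x + h) @^-1` A) by [].
by apply: open_comp => // x _; exact: continuous_translate.
Qed.

Lemma ge0_integral_translate (v : 'rV[R]_n) (f : 'rV[R]_n -> \bar R) :
  measurable_fun setT f -> (forall x, (0 <= f x)%E) ->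
  (\int[mu]_x f (x + v)%R = \int[mu]_x f x)%E.
Proof.
move=> mf f0; rewrite [RHS](ge0_integral_affine v (oner_neq0 R))//.
rewrite normr1 expr1n mul1e; apply: eq_integral => x _.
by rewrite scale1r.
Qed.

Lemma integral_translate (v : 'rV[R]_n) (f : 'rV[R]_n -> \bar R) :
  measurable_fun setT f -> (\int[mu]_x f (x + v)%R = \int[mu]_x f x)%E.
Proof.
move=> mf; rewrite integralE [RHS]integralE; congr (_ - _)%E.
  rewrite -[RHS](ge0_integral_translate v)//; last exact: measurable_funepos.
  by rewrite -/(f \o (fun x => x + v)) funepos_comp.
rewrite -[RHS](ge0_integral_translate v)//; last exact: measurable_funeneg.
by rewrite -/(f \o (fun x => x + v)) funeneg_comp.
Qed.

Lemma integrable_translate (v : 'rV[R]_n) (f : 'rV[R]_n -> \bar R) :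
  mu.-integrable setT f -> mu.-integrable setT (fun x => f (x + v)).
Proof.
move=> /integrableP[mf fi]; apply/integrableP; split.
  exact: measurableT_comp mf (measurable_translate v).
rewrite (ge0_integral_translate v (f := fun x => `|f x|%E))//.
exact: measurableT_comp.
Qed.

(* The inner integral may be infinite on a negligible set of x, where [fine]
   returns 0. *)
Lemma fubini_weight d (T : measurableType d)
    (nu : {sigma_finite_measure set T -> \bar R})
    (K : 'rV[R]_n * T -> R) (phi : 'rV[R]_n -> R) (C : R) :
  (mu \x nu)%E.-integrable setT (EFin \o K) ->
  measurable_fun setT phi -> (forall x, `|phi x| <= C) ->
  (\int[mu]_x (fine (\int[nu]_t (K (x, t))%:E) * phi x)%:E =
   \int[nu]_t \int[mu]_x (K (x, t) * phi x)%:E)%E.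
Proof.
move=> Ki mphi phiC.
have Kpi : (mu \x nu)%E.-integrable setT (fun p => (K p * phi p.1)%:E).
  apply: (integrable_mul_bounded Ki (C := C)) => //.
  exact: measurableT_comp mphi measurable_fst.
rewrite -[RHS](Fubini Kpi)/=.
apply: ae_eq_integral => //.
- apply/measurable_EFinP/measurable_funM => //.
  apply: measurableT_comp; first exact: fine_measurable.
  exact: measurable_fubini_F Ki.
- exact: measurable_fubini_F Kpi.
- have := ae_integrable1 Ki; apply: filterS => x Kx _ /=.
  have Kfin : (\int[nu]_t (K (x, t))%:E)%E \is a fin_num by exact: integrable_fin_num Kx.
  rewrite EFinM fineK// -integralZr//.
Qed.

(** The slices at fixed t have L1 norm at most M, and t ranges over an interval of length 1, so the
    double integral of |K| is at most M. *)
Lemma integrable_slab (K : 'rV[R]_n * measurableTypeR R -> R) (M : \bar R) :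
  measurable_fun setT K ->
  (M < +oo)%E ->
  (forall t, 0 <= t <= 1 -> (\int[mu]_x `|K (x, t)|%:E <= M)%E) ->
  (forall x t, ~~ (0 <= t <= 1) -> K (x, t) = 0) ->
  (mu \x lebesgue_measure)%E.-integrable setT (EFin \o K).
Proof.
move=> mK Moo KM K0; apply/integrable21ltyP; first exact/measurable_EFinP.
have mI : measurable (`[0%R, 1%R]%classic : set (measurableTypeR R)) by [].
have M0 : (0 <= M)%E.
  have t0 : 0 <= (0 : R) <= 1 by rewrite lexx ler01.
  have I0 : (0 <= \int[mu]_x `|K (x, 0%R)|%:E)%E by exact: integral_ge0.
  exact: le_trans I0 (KM 0 t0).
apply: (@le_lt_trans _ _ (\int[lebesgue_measure]_(t in `[0%R, 1%R]) M)%E).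
  rewrite [leRHS]integral_mkcond; apply: ge0_le_integral => //.
  - by move=> t _; exact: integral_ge0.
  - apply: (measurable_fun_fubini_tonelli_G (fun p => `|(K p)%:E|%E)) => //.
    by apply: measurableT_comp => //; exact/measurable_EFinP.
  - by apply/(measurable_restrictT _ mI).
  - move=> t _; rewrite patchE; case: ifPn => [|t01].
      by rewrite inE/= in_itv/=; exact: KM.
    rewrite integral0_eq// => x _ /=; rewrite K0 ?normr0//.
    by apply: contra t01 => t01; rewrite inE/= in_itv.
rewrite integral_cst//= lebesgue_measure_itv/= lte_fin ltr01 oppr0 adde0 mule1//.
Qed.

End integration_tools.

(** * Increments along segments *)

Section weak_line.
Context {R : realType} {n : nat}.
Local Notation mu := (@lebesgue_rV R n).
Local Notation lam := (@lebesgue_measure R).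

Lemma bump_on_translate (a b c : R) (f : R -> R) :
  bump_on a b f -> bump_on (a + c) (b + c) (fun s => f (s - c)).
Proof.
move=> [Cf f0]; split=> [m|x xab].
  rewrite (_ : (fun _ => _) = (fun s => f (1 * s + (- c)))).
    exact: Cn_affine.
  by apply/funext => s; rewrite mul1r.
by apply: f0; rewrite lerBrDr lerBlDr.
Qed.

Lemma bumps_on_translate (a b v : 'rV[R]_n) (f : 'I_n -> R -> R) :
  bumps_on a b f ->
  bumps_on (a + v) (b + v) (fun i s => f i (s - v ord0 i)).
Proof. by move=> Df i; rewrite !mxE; exact: bump_on_translate. Qed.

Lemma prodf_translate (v x : 'rV[R]_n) (f : 'I_n -> R -> R) :
  prodf (fun i s => f i (s - v ord0 i)) x = prodf f (x - v).
Proof. by apply: eq_bigr => i _; rewrite !mxE. Qed.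

Lemma diff_at_translate (a b v : 'rV[R]_n) (f : 'I_n -> R -> R) i :
  bumps_on a b f ->
  diff_at (fun i s => f i (s - v ord0 i)) i =
  (fun j s => diff_at f i j (s - v ord0 j)).
Proof.
move=> Df; apply/funext => j; apply/funext => s; rewrite /diff_at.
case: ifP => // _; rewrite derive1E; apply: derive_val.
rewrite -[X in is_derive _ _ _ X]mulr1.
apply: (@is_derive1_comp R (f j) (fun s => s - v ord0 j)).
  exact: bump_on_is_derive (Df j).
by apply: is_derive_eq; rewrite subr0.
Qed.

(* Takes values in the extended reals: the restriction of g to a given segment
   need not be integrable. *)
Definition segment_integral (g : 'rV[R]_n -> R) (x h : 'rV[R]_n) : \bar R :=
  (\int[lam]_t (g (x + t *: h)%R * \1_`[0%R, 1%R] t)%:E)%E.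

(** For t in [0, 1] the slice is a translate of g, so the L1 norm of g is a bound uniform in t.
    Consequently [segment_integral g x h] is finite for almost every x. *)
Lemma integrable_segment (g : 'rV[R]_n -> R) (h : 'rV[R]_n) :
  mu.-integrable setT (EFin \o g) ->
  (mu \x lam)%E.-integrable setT
    (EFin \o (fun p : 'rV[R]_n * measurableTypeR R =>
        g (p.1 + p.2 *: h) * \1_`[0%R, 1%R] p.2)).
Proof.
move=> ig.
have mg : measurable_fun setT g by apply/measurable_EFinP; exact: measurable_int ig.
apply: (@integrable_slab _ _ _ (\int[mu]_x `|(g x)%:E|)%E).
- apply: measurable_funM.
    apply: measurableT_comp => //.
    apply: (@measurable_rV_line R n _ _ fst (fun=> h) snd).
    + exact: measurable_fst.
    + exact: measurable_snd.
    + exact: measurable_cst.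
  apply: measurableT_comp; last exact: measurable_snd.
  exact: measurable_indic.
- by have /integrableP[] := ig.
- move=> t t01; rewrite -[leRHS](integral_translate (t *: h)); last first.
    by apply: measurableT_comp => //; exact/measurable_EFinP.
  rewrite le_eqVlt; apply/orP; left; apply/eqP; apply: eq_integral => x _ /=.
  by rewrite indicE mem_set ?mulr1//= in_itv.
- move=> x t t01; rewrite /= indicE memNset ?mulr0//=.
  by rewrite in_itv/=; exact/negP.
Qed.

(* With Phi a test function on the intersection of Omega and
   Omega - h, [x |-> Phi (x - t h)] is one on Omega for 0 <= t <= 1; the fundamental theorem
   of calculus is applied to [t |-> Phi (x - t h)]. *)
Lemma weak_line (Omega : set 'rV[R]_n) (h : 'rV[R]_n) (u g : 'rV[R]_n -> R) :
  open Omega ->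
  (forall x t, Omega x -> Omega (x + h) -> 0 <= t <= 1 -> Omega (x + t *: h)) ->
  mu.-integrable setT (EFin \o u) -> mu.-integrable setT (EFin \o g) ->
  (forall a b f, bumps_on a b f -> cbox a b `<=` Omega ->
    \int[mu]_x (g x * prodf f x)%:E =
    \int[mu]_x (- (u x * \sum_i h ord0 i * prodf (diff_at f i) x))%:E)%E ->
  {ae mu, forall x, Omega x -> Omega (x + h) ->
    u (x + h) - u x = fine (segment_integral g x h)}.
Proof.
move=> oO cO iu ig wg.
have mu_ : measurable_fun setT u by apply/measurable_EFinP; exact: measurable_int iu.
have mg : measurable_fun setT g by apply/measurable_EFinP; exact: measurable_int ig.
pose U := Omega `&` [set x | Omega (x + h)].
have oU : open U.
  by apply: openI => //; exact: open_translate.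
have iK := integrable_segment h ig.
pose F x := fine (segment_integral g x h).
have iF : mu.-integrable setT (EFin \o F).
  have iS := integrable_fubini_F iK.
  apply: (le_integrable measurableT _ _ iS).
    apply/measurable_EFinP; apply: measurableT_comp; first exact: fine_measurable.
    exact: measurable_int iS.
  move=> x _; rewrite /F /segment_integral /fubini_F /=.
  by case: (integral _ _ _) => [r| |]; rewrite //= normr0 leey.
have iuh := integrable_translate h iu.
have iuB : mu.-integrable setT (EFin \o (fun x => u (x + h) - u x)).
  rewrite (_ : _ \o _ = ((fun x => (u (x + h)%R)%:E) \- (EFin \o u))%E) //.
  exact: integrableB.
suff : {ae mu, forall x, U x -> u (x + h) - u x - F x = 0}.
  by apply: filterS => x wx Ox Oxh; apply/eqP; rewrite -subr_eq0 wx.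
apply: ae_eq0_pbump => //.
  rewrite (_ : _ \o _ = ((EFin \o (fun x => u (x + h) - u x)%R) \- (EFin \o F))%E) //.
  exact: integrableB.
move=> k a b abU.
have Df : bumps_on a b _ := bumps_on_bump k a b.
set f := (fun i => bump k (a ord0 i) (b ord0 i)) in Df.
rewrite /pbump -/f.
have [C CP] := prodf_bounded Df.
have mf := measurable_prodf Df.
pose S x := \sum_i h ord0 i * prodf (diff_at f i) x.
have Dd i : bumps_on a b (diff_at f i) := bumps_on_diff_at i Df.
have mS : measurable_fun setT S.
  apply: measurable_sum => i; apply: measurable_funM => //.
  exact: measurable_prodf (Dd i).
have [CS CSP] : exists C', forall x, `|S x| <= C'.
  have [c cP] := fin_all_exists (fun i => prodf_bounded (Dd i)).
  exists (\sum_i `|h ord0 i| * c i) => x.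
  rewrite (le_trans (ler_norm_sum _ _ _))// ler_sum// => i _.
  by rewrite normrM ler_wpM2l.
have mfh (v : 'rV[R]_n) : measurable_fun setT (fun x : 'rV[R]_n => prodf f (x - v)).
  by apply: measurableT_comp => //; exact: measurable_translate.
(* Translating by t h moves the shift from g to the test function. The shifted box stays in Omega by
   the segment hypothesis [cO], so [wg] applies to it. *)
have key t : 0 <= t <= 1 ->
    (\int[mu]_x (g (x + t *: h) * prodf f x)%:E =
     \int[mu]_x (- (u x * S (x - t *: h)))%:E)%E.
  move=> t01; pose H z := (g z * prodf f (z - t *: h))%:E.
  transitivity (\int[mu]_x H (x + t *: h)%R)%E.
    by apply: eq_integral => x _; rewrite /H addrK.
  rewrite integral_translate; last first.
    by apply/measurable_EFinP; exact: measurable_funM.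
  have sub : cbox (a + t *: h) (b + t *: h) `<=` Omega.
    move=> y yab; have : cbox a b (y - t *: h).
      by move=> i; have := yab i; rewrite !mxE lerBrDr lerBlDr.
    by move=> /abU[Oy Oyh]; have := cO _ _ Oy Oyh t01; rewrite subrK.
  have := wg _ _ _ (bumps_on_translate (t *: h) Df) sub.
  under eq_integral do rewrite prodf_translate.
  move=> ->; apply: eq_integral => x _; congr (- (_ * _))%:E.
  apply: eq_bigr => i _; congr (_ * _).
  by rewrite (diff_at_translate _ _ Df) prodf_translate.
(* Moving in direction - h, the product function has derivative - S (x - t h) in t, so only its two
   end values survive. *)
have FTC x : (\int[lam]_t (- (u x * S (x - t *: h)) * \1_`[0%R, 1%R] t)%:E =
    (u x * (prodf f (x - h) - prodf f x))%:E)%E.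
  pose phi (t : R) := prodf f (x + t *: - h).
  pose dphi (t : R) := \sum_i (- h) ord0 i * prodf (diff_at f i) (x + t *: - h).
  have dphiE t : dphi t = - S (x - t *: h).
    rewrite /dphi /S -sumrN; apply: eq_bigr => i _.
    by rewrite mxE mulNr scalerN.
  have dP (t : R) : is_derive t 1 phi (dphi t) := is_derive_prodf_line x (- h) t Df.
  have cd : continuous dphi.
    rewrite (_ : dphi = \sum_i (fun t : R => (- h) ord0 i * prodf (diff_at f i) (x + t *: - h))).
      elim/big_ind: _ => [|f1 f2 c1 c2|i _].
      - by move=> t; exact: (@cvg_cst _ (0 : R)).
      - by move=> t; apply: cvgD; [exact: c1|exact: c2].
      - move=> t; apply: cvgMr.
        exact: (is_derive_continuous (fun s => is_derive_prodf_line x (- h) s (Dd i))).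
    by apply/funext => t; rewrite fct_sumE.
  transitivity (\int[lam]_(t in `[0%R, 1%R]) ((u x)%:E * (dphi t)%:E))%E.
    rewrite [RHS]integral_mkcond; apply: eq_integral => t _.
    rewrite patchE indicE; case: ifPn => _; last by rewrite mulr0.
    by rewrite -EFinM dphiE mulr1 mulrN.
  rewrite integralZl//; last first.
    apply: continuous_compact_integrable; first exact: segment_compact.
    exact: continuous_subspaceT.
  by rewrite (FTC_01 dP cd) -EFinM /phi scale1r scale0r addr0.
have iL : (mu \x lam)%E.-integrable setT
    (EFin \o (fun p : 'rV[R]_n * measurableTypeR R =>
       - (u p.1 * S (p.1 - p.2 *: h)) * \1_`[0%R, 1%R] p.2)).
  apply: (@integrable_slab _ _ _ (\int[mu]_x (`|CS|%:E * `|(u x)%:E|))%E).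
  - apply: measurable_funM; last first.
      apply: measurableT_comp; last exact: measurable_snd.
      exact: measurable_indic.
    apply: measurable_funN; apply: measurable_funM.
      exact: measurableT_comp mu_ measurable_fst.
    apply: (measurableT_comp mS).
    rewrite (_ : (fun _ => _) = (fun p : 'rV[R]_n * measurableTypeR R => p.1 + p.2 *: (- h))).
      apply: (@measurable_rV_line R n _ _ fst (fun=> - h) snd).
      + exact: measurable_fst.
      + exact: measurable_snd.
      + exact: measurable_cst.
    by apply/funext => p; rewrite scalerN.
  - have /integrableP[_ h1] := integrableZl measurableT `|CS| (integrable_abse iu).
    apply: le_lt_trans h1; apply: ge0_le_integral => //.
    + by apply: measurable_funeM; apply: measurableT_comp => //; exact/measurable_EFinP.
    + apply: measurableT_comp => //; apply: measurable_funeM.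
      by apply: measurableT_comp => //; exact/measurable_EFinP.
    + by move=> x _; exact: lee_abs.
  - move=> t t01; apply: ge0_le_integral => //.
    + apply/measurable_EFinP; apply: measurableT_comp => //=.
      apply: measurable_funM => //; apply: measurable_funN; apply: measurable_funM => //.
      exact: measurableT_comp mS (measurable_translate (- (t *: h))).
    + by apply: measurable_funeM; apply: measurableT_comp => //; exact/measurable_EFinP.
    + move=> x _; rewrite /= indicE mem_set ?mulr1/=; last by rewrite in_itv.
      rewrite normrN normrM mulrC -EFinM lee_fin ler_wpM2r//.
      by rewrite (le_trans (CSP _))// ler_norm.
  - move=> x t t01; rewrite /= indicE memNset ?mulr0//=.
    by rewrite in_itv/=; exact/negP.
(* One use of Fubini writes the left side as an integral over t, [key] rewrites each slice, and a
   second use brings the integral over t inside, where [FTC] evaluates it. *)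
have EF : (\int[mu]_x (F x * prodf f x)%:E =
    \int[mu]_x (u x * (prodf f (x - h) - prodf f x))%:E)%E.
  rewrite (fubini_weight iK mf CP).
  transitivity (\int[lam]_t \int[mu]_x
      (- (u x * S (x - t *: h)) * \1_`[0%R, 1%R] t)%:E)%E.
    apply: eq_integral => t _; rewrite /= indicE.
    have [t01|t01] := boolP (t \in `[0%R, 1%R]%classic).
      rewrite inE /= in_itv/= in t01.
      under eq_integral do rewrite mulr1.
      under [RHS]eq_integral do rewrite mulr1.
      exact: key.
    under eq_integral do rewrite mulr0 mul0r.
    by under [RHS]eq_integral do rewrite mulr0.
  rewrite -(Fubini iL)/=; apply: eq_integral => x _; exact: FTC.
have iuf : mu.-integrable setT (EFin \o (fun x => u x * prodf f x)).
  exact: integrable_mul_bounded CP.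
have iufh : mu.-integrable setT (EFin \o (fun x => u x * prodf f (x - h))).
  by apply: integrable_mul_bounded => //; exact: mfh.
have iA : mu.-integrable setT (EFin \o (fun x => (u (x + h) - u x) * prodf f x)).
  exact: integrable_mul_bounded CP.
have iFf : mu.-integrable setT (EFin \o (fun x => F x * prodf f x)).
  exact: integrable_mul_bounded CP.
have iuhf : mu.-integrable setT (EFin \o (fun x => u (x + h) * prodf f x)).
  exact: integrable_mul_bounded CP.
have EA : (\int[mu]_x ((u (x + h) - u x) * prodf f x)%:E =
    \int[mu]_x (F x * prodf f x)%:E)%E.
  rewrite EF.
  under eq_integral do rewrite mulrBl EFinB.
  under [RHS]eq_integral do rewrite mulrBr EFinB.
  rewrite [LHS](integralB_EFin measurableT iuhf iuf).
  rewrite [RHS](integralB_EFin measurableT iufh iuf); congr (_ - _)%E.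
  (* Translation by h turns u x against the bump at x - h into u (x + h) against the bump at x. *)
  rewrite -[RHS](integral_translate h); last exact: measurable_int iufh.
  by apply: eq_integral => x _; rewrite addrK.
under eq_integral do rewrite mulrBl EFinB.
rewrite integralB_EFin// EA subee//.
exact: integrable_fin_num iFf.
Qed.

End weak_line.

(** * Riesz potential estimate *)

Section enorm.
Context {R : realType} {n : nat}.
Implicit Types x y : 'rV[R]_n.

Lemma enorm_ge0 x : 0 <= enorm x.
Proof. exact: sqrtr_ge0. Qed.

Lemma sqr_enorm x : enorm x ^+ 2 = \sum_i x ord0 i ^+ 2.
Proof. by rewrite sqr_sqrtr// sumr_ge0// => i _; exact: sqr_ge0. Qed.

Lemma enormZ (c : R) x : enorm (c *: x) = `|c| * enorm x.
Proof.
rewrite /enorm -sqrtr_sqr -sqrtrM ?sqr_ge0// mulr_sumr.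
by congr Num.sqrt; apply: eq_bigr => i _; rewrite mxE exprMn.
Qed.

Lemma enormN x : enorm (- x) = enorm x.
Proof. by rewrite -scaleN1r enormZ normrN1 mul1r. Qed.

Lemma enorm_eq0 x : enorm x = 0 -> x = 0.
Proof.
move=> x0; have := sqr_enorm x; rewrite x0 expr0n/= => /esym/eqP.
rewrite psumr_eq0 => [/allP xi|i _]; last exact: sqr_ge0.
apply/rowP => i; rewrite mxE; apply/eqP; rewrite -sqrf_eq0.
by apply: xi; rewrite mem_index_enum.
Qed.

Lemma le_coord_enorm x i : `|x ord0 i| <= enorm x.
Proof.
rewrite -sqrtr_sqr ler_wsqrtr// (bigD1 i)//= lerDl sumr_ge0// => j _.
exact: sqr_ge0.
Qed.

Lemma enorm_le_sum x : enorm x <= \sum_i `|x ord0 i|.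
Proof.
have s0 : 0 <= \sum_i `|x ord0 i| by exact: sumr_ge0.
rewrite -[leRHS]ger0_norm// -sqrtr_sqr ler_wsqrtr// expr2 mulr_suml.
apply: ler_sum => i _; rewrite -(real_normK (num_real (x ord0 i))) expr2.
by rewrite ler_wpM2l// (bigD1 i)//= lerDl sumr_ge0.
Qed.

Lemma CauchySchwarz_enorm x y :
  `|\sum_i x ord0 i * y ord0 i| <= enorm x * enorm y.
Proof.
have [/enorm_eq0 ->|x0] := eqVneq (enorm x) 0.
  rewrite big1 ?normr0 ?mulr_ge0 ?enorm_ge0// => i _.
  by rewrite mxE mul0r.
set s := \sum_i _.
have xp : 0 < enorm x by rewrite lt_neqAle eq_sym x0 enorm_ge0.
rewrite -(@ler_pXn2r _ 2)// ?nnegrE ?mulr_ge0 ?enorm_ge0//.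
rewrite real_normK ?num_real// exprMn.
(* This sum of squares equals |x|^2 (|x|^2 |y|^2 - s^2). *)
have : 0 <= \sum_i (enorm x ^+ 2 * y ord0 i - s * x ord0 i) ^+ 2.
  by apply: sumr_ge0 => i _; exact: sqr_ge0.
rewrite (eq_bigr (fun i => (enorm x ^+ 2) ^+ 2 * y ord0 i ^+ 2 -
  (enorm x ^+ 2 * s *+ 2) * (x ord0 i * y ord0 i) + s ^+ 2 * x ord0 i ^+ 2)); last first.
  by move=> i _; ring.
rewrite big_split/= sumrB -!mulr_sumr -!sqr_enorm -/s.
rewrite (_ : _ + _ = enorm x ^+ 2 * (enorm x ^+ 2 * enorm y ^+ 2 - s ^+ 2)); last by ring.
by rewrite pmulr_rge0 ?exprn_gt0// subr_ge0.
Qed.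

Lemma measurable_enorm : measurable_fun setT (@enorm R n).
Proof.
apply: measurableT_comp.
  exact: continuous_measurable_fun (@sqrt_continuous R).
apply: measurable_sum => i; apply: measurable_funX; exact: measurable_coor.
Qed.

(** [sup] dominates its set only when an upper bound exists; a cube containing Omega supplies
    one. *)
Lemma diam_ge (Omega : set 'rV[R]_n) x y :
  bounded_set Omega -> Omega x -> Omega y -> enorm (x - y) <= diam Omega.
Proof.
move=> /bounded_sub_cbox[M M0 OM] Ox Oy; apply: ub_le_sup; last by exists (x, y).
exists (\sum_(i < n) (M + M)) => _ [[a b] [/= /OM Oa /OM Ob] <-].
rewrite (le_trans (enorm_le_sum _))// ler_sum// => i _.
have := Oa i; have := Ob i; rewrite !mxE => /andP[? ?] /andP[? ?].
by rewrite ler_norml; apply/andP; split; lra.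
Qed.

End enorm.

(** * Integral of a negative power *)

Section power_integral.
Context {R : realType}.

(** The factors n^-1 and n are left uncancelled, so that the formula is also true for n = 0. *)
Lemma is_derive_invX (n : nat) (x : R) : x != 0 ->
  is_derive x 1 (fun t : R => - (n%:R^-1) * t ^- n) (n%:R^-1 * (n%:R * x ^- n.+1)).
Proof.
move=> x0.
have dX : is_derive x 1 (fun t : R => t ^+ n) (n%:R * x ^+ n.-1).
  have := @is_deriveX R R id n x 1 1 _; rewrite -[_ *: _]/(_ * _) mulr1 => h.
  rewrite (_ : (fun t => _) = (id : R -> R) ^+ n); first exact: h.
  by apply/funext => t; rewrite exprfctE.
have dV := @is_deriveV R (fun t => t ^+ n) x _ 1 (expf_neq0 n x0) dX.
have h : is_derive x 1 (fun t : R => - (n%:R^-1) * t ^- n) _ := is_deriveZ (- n%:R^-1) dV.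
apply: (is_derive_eq h).
rewrite -[_ *: _]/(_ * _) -[X in _ * X]/(_ * _).
case: n {dX dV h} => [|n]; first by rewrite invr0 oppr0 !mul0r.
rewrite /= mulNr -mulrN mulNr opprK; congr (_ * _).
rewrite mulrCA; congr (_ * _); rewrite -exprM -!exprVn muln2 -addnn addnS addSn.
rewrite (_ : (n + n).+2 = (n.+2 + n)%N); last by rewrite !addSn.
by rewrite exprD -mulrA -exprMn mulVf// expr1n mulr1.
Qed.

(** For a <= 1 the integral is (a^(-n) - 1) / n. Dropping - 1 / n gives a bound that also covers a >
    1, where the interval is empty. *)
Lemma integral_powRN_le (a : R) (n : nat) : (0 < n)%N -> 0 < a ->
  (\int[lebesgue_measure]_(t in `[a, 1%R]) (t `^ (- n.+1%:R))%:E <=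
   (a ^- n / n%:R)%:E)%E.
Proof.
move=> n0 a0.
have rhs0 : 0 <= a ^- n / n%:R by rewrite divr_ge0// invr_ge0 exprn_ge0// ltW.
have [a1|a1|->] := ltgtP a 1; last 2 first.
- by rewrite set_itv_ge ?integral_set0 ?lee_fin//= -ltNge.
- by rewrite set_itv1 integral_set1 lee_fin expr1n invr1 mul1r invr_ge0.
pose f (t : R) := t ^- n.+1; pose F (t : R) := - n%:R^-1 * t ^- n.
have pos t : t \in `[a, 1] -> 0 < t.
  by rewrite in_itv/= => /andP[+ _]; exact: lt_le_trans.
have dF (t : R) : 0 < t -> is_derive t 1 F (f t).
  move=> t0; have := @is_derive_invX n t (lt0r_neq0 t0).
  by rewrite mulrA mulVf ?mul1r// pnatr_eq0 -lt0n.
have -> : (\int[lebesgue_measure]_(t in `[a, 1%R]) (t `^ (- n.+1%:R))%:E =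
    \int[lebesgue_measure]_(t in `[a, 1%R]) (f t)%:E)%E.
  apply: eq_integral => t; rewrite inE/= => /pos t0.
  by rewrite /f/= powRN powR_mulrn// ltW.
rewrite (@continuous_FTC2 _ f F)//.
- rewrite /F expr1n invr1 mulr1 -EFinB lee_fin mulNr opprK addrC mulrC.
  by rewrite lerBlDr lerDl invr_ge0.
- apply: continuous_in_subspaceT => t; rewrite inE/= => /pos t0.
  have h : (t : R) ^+ n.+1 != 0 by rewrite expf_neq0// gt_eqF.
  have c := @continuousV R R (fun t : R => t ^+ n.+1) t h (@exprn_continuous R n.+1 t).
  exact: c.
- have cF t : 0 < t -> {for t, continuous F}.
    by move=> t0; apply/differentiable_continuous/derivable1_diffP; case: (dF t t0).
  split.
  + move=> t; rewrite in_itv/= => /andP[at1 _].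
    by case: (dF t (lt_trans a0 at1)).
  + by apply: cvg_at_right_filter; exact: cF.
  + by apply: cvg_at_left_filter; exact: cF.
- move=> t; rewrite in_itv/= => /andP[at1 _]; rewrite derive1E.
  by have d := dF t (lt_trans a0 at1); exact: derive_val.
Qed.

End power_integral.

Section riesz.
Context {R : realType} {N : nat}.
Local Notation mu := (@lebesgue_rV R N).
Local Notation lam := (@lebesgue_measure R).

Lemma segment_riesz (Omega : set 'rV[R]_N) (x : 'rV[R]_N) (G : 'rV[R]_N -> R) :
  (0 < N)%N -> open Omega -> bounded_set Omega -> Omega x ->
  measurable_fun setT G -> (forall z, 0 <= G z) -> (forall z, ~ Omega z -> G z = 0) ->
  (\int[mu]_y \int[lam]_t
     (\1_Omega y * (G (x + t *: (y - x)) * enorm (y - x) * \1_`]0%R, 1%R] t))%:E <=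
   (diam Omega ^+ N / N%:R)%:E *
   \int[mu]_z (G z * enorm (x - z) `^ (1 - N%:R))%:E)%E.
Proof.
move=> N0 oO bO Ox mG G0 GO; set d := diam Omega.
have mO := open_measurable_rV oO.
pose T := ('rV[R]_N * measurableTypeR R)%type.
pose A (p : T) := \1_Omega p.1 *
  (G (x + p.2 *: (p.1 - x)) * enorm (p.1 - x) * \1_`]0%R, 1%R] p.2).
(* The integrand after the substitution, with the membership of y in Omega relaxed to |x - z| <= t
   d. *)
pose B (p : T) := G p.1 * enorm (x - p.1) *
  (p.2 `^ (- N.+1%:R) * ((enorm (x - p.1) <= p.2 * d)%R%:R * \1_`]0%R, 1%R] p.2)).
have m1 : measurable_fun setT (fst : T -> _) by exact: measurable_fst.
have m2 : measurable_fun setT (snd : T -> _) by exact: measurable_snd.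
have mI : measurable_fun setT (fun p : T => \1_`]0%R, 1%R] p.2 : R).
  apply: measurableT_comp m2; exact: measurable_indic.
have mB : measurable_fun setT (fun p : T => p.1 - x).
  exact: (measurableT_comp (measurable_translate (- x)) m1).
have mB' : measurable_fun setT (fun p : T => x - p.1).
  rewrite (_ : (fun _ => _) = (fun p : T => (-1) *: p.1 + x)).
    exact: measurable_rV_affine.
  by apply/funext => p; rewrite scaleN1r addrC.
have mEB : measurable_fun setT (fun p : T => enorm (p.1 - x)).
  exact: (measurableT_comp measurable_enorm mB).
have mEB' : measurable_fun setT (fun p : T => enorm (x - p.1)).
  exact: (measurableT_comp measurable_enorm mB').
have mOi : measurable_fun setT (\1_Omega : 'rV[R]_N -> R) by exact: measurable_indic.
have mA : measurable_fun setT A.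
  apply: measurable_funM.
    exact: (measurableT_comp mOi m1).
  apply: measurable_funM => //; apply: measurable_funM => //.
  by apply: (measurableT_comp mG); apply: (@measurable_rV_line R N _ _ (fun=> x)) => //.
have mp : measurable_fun setT (fun t : measurableTypeR R => t `^ (- N.+1%:R)).
  exact: measurable_powR.
have mBB : measurable_fun setT B.
  apply: measurable_funM; first by apply: measurable_funM => //; exact: (measurableT_comp mG m1).
  apply: measurable_funM; first exact: (measurableT_comp mp m2).
  apply: measurable_funM => //.
  rewrite (_ : (fun _ => _) = (fun p : T => if enorm (x - p.1) <= p.2 * d then 1 else 0 : R)).
    apply: measurable_fun_ifT => //.
    by apply: measurable_fun_ler => //; exact: measurable_funM.
  by apply/funext => p; case: ifP.
have A0 p : 0 <= A p by rewrite /A !mulr_ge0 ?enorm_ge0.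
have B0 p : 0 <= B p by rewrite /B !mulr_ge0 ?enorm_ge0 ?powR_ge0.
have sA t : measurable_fun setT (fun y => (A (y, t))%:E).
  by apply/measurable_EFinP; exact: measurable_fun_pair1 mA.
have sB t : measurable_fun setT (fun y => (B (y, t))%:E).
  by apply/measurable_EFinP; exact: measurable_fun_pair1 mBB.
have sB2 y : measurable_fun setT (fun t => (B (y, t))%:E).
  by apply/measurable_EFinP; exact: measurable_fun_pair2 mBB.
have mEA : measurable_fun setT (fun p => (A p)%:E) by exact/measurable_EFinP.
have mEBB : measurable_fun setT (fun p => (B p)%:E) by exact/measurable_EFinP.
have eA : (\int[mu]_y \int[lam]_t (A (y, t))%:E = \int[lam]_t \int[mu]_y (A (y, t))%:E)%E.
  by apply: (@fubini_tonelli _ _ _ _ _ mu lam (fun p => (A p)%:E)).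
have eB : (\int[mu]_y \int[lam]_t (B (y, t))%:E = \int[lam]_t \int[mu]_y (B (y, t))%:E)%E.
  by apply: (@fubini_tonelli _ _ _ _ _ mu lam (fun p => (B p)%:E)).
rewrite [leLHS]eA.
have A0e p : (0 <= (A p)%:E)%E by rewrite lee_fin.
have B0e p : (0 <= (B p)%:E)%E by rewrite lee_fin.
apply: (@le_trans _ _ (\int[lam]_t \int[mu]_y (B (y, t))%:E)%E).
  apply: ge0_le_integral => //.
  - by move=> t _; apply: integral_ge0.
  - exact: (measurable_fun_fubini_tonelli_G (fun p => (A p)%:E)).
  - exact: (measurable_fun_fubini_tonelli_G (fun p => (B p)%:E)).
  move=> t _; have [t01|t01] := boolP (t \in `]0%R, 1%R]%classic); last first.
    rewrite integral0_eq ?integral_ge0// => y _; rewrite /A/= [X in _ * (_ * X)]indicE.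
    by rewrite (_ : t \in _ = false) ?mulr0//; exact/negbTE.
  have /andP[t0 t1] : 0 < t <= 1 by move: t01; rewrite inE/= in_itv.
  have tV0 : t^-1 != 0 by rewrite invr_eq0 gt_eqF.
  (* The inverse of y |-> x + t (y - x), in the affine form that [ge0_integral_affine] expects. *)
  pose y z := t^-1 *: z + (x - t^-1 *: x).
  have yx z : y z - x = t^-1 *: (z - x).
    by rewrite /y/= addrCA addrAC subrr add0r scalerBr.
  have xy z : x + t *: (y z - x) = z.
    by rewrite yx scalerA divff ?gt_eqF// scale1r addrC subrK.
  rewrite (ge0_integral_affine (x - t^-1 *: x) tV0)// -/y.
  have mAy : measurable_fun setT (fun z => (A (y z, t))%:E).
    by apply: (measurableT_comp (sA t)); exact: measurable_rV_affine.
  rewrite -ge0_integralZl//.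
  apply: ge0_le_integral => //.
  - by move=> z _; rewrite mule_ge0// lee_fin exprn_ge0.
  - exact: measurable_funeM.
  move=> z _; rewrite -EFinM lee_fin /A /B/= xy !indicE t01.
  have [Oy|_] := boolP (y z \in Omega); last first.
    by rewrite mul0r mulr0 !mulr_ge0 ?enorm_ge0 ?powR_ge0.
  have rt : enorm (x - z) <= t * d.
    have := diam_ge bO Ox (set_mem Oy).
    rewrite -enormN opprB yx enormZ ger0_norm ?invr_ge0 ?(ltW t0)//.
    by rewrite ler_pdivrMl// -enormN opprB.
  rewrite rt yx enormZ -[enorm (z - x)]enormN opprB.
  rewrite powRN powR_mulrn ?(ltW t0)// ger0_norm ?invr_ge0 ?(ltW t0)//.
  by rewrite le_eqVlt -exprVn exprS; apply/orP; left; apply/eqP; ring.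
have d0 : 0 <= d by exact: le_trans (enorm_ge0 _) (diam_ge bO Ox Ox).
have mk : measurable_fun setT (fun z : 'rV[R]_N => G z * enorm (x - z) `^ (1 - N%:R)).
  apply: measurable_funM => //.
  have mxz : measurable_fun setT (fun z : 'rV[R]_N => x - z).
    rewrite (_ : (fun _ => _) = (fun z : 'rV[R]_N => (-1) *: z + x)).
      exact: measurable_rV_affine.
    by apply/funext => z; rewrite scaleN1r addrC.
  have mq : measurable_fun setT (fun s : R => s `^ (1 - N%:R)) by exact: measurable_powR.
  exact: (measurableT_comp mq (measurableT_comp measurable_enorm mxz)).
have k0 z : 0 <= G z * enorm (x - z) `^ (1 - N%:R) by rewrite mulr_ge0 ?powR_ge0.
have c0 : 0 <= d ^+ N / N%:R by rewrite divr_ge0// exprn_ge0.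
rewrite -eB -ge0_integralZl//; last 2 first.
- exact/measurable_EFinP.
- by move=> z _; rewrite lee_fin.
apply: ge0_le_integral => //.
- by move=> z _; apply: integral_ge0.
- exact: (measurable_fun_fubini_tonelli_F (fun p => (B p)%:E)).
- by apply: measurable_funeM; exact/measurable_EFinP.
move=> z _; rewrite -EFinM.
have rhs0 : 0 <= d ^+ N / N%:R * (G z * enorm (x - z) `^ (1 - N%:R)) by rewrite mulr_ge0.
set r := enorm (x - z) in rhs0 *.
(* At z = x the factor r makes the inner integral 0; from here on r can be divided by. *)
have [r0|rN0] := eqVneq r 0.
  by rewrite integral0_eq ?lee_fin// => t _; rewrite /B/= -/r r0 mulr0 mul0r.
have [Oz|/GO Gz] := pselect (Omega z); last first.
  by rewrite integral0_eq ?lee_fin// => t _; rewrite /B/= Gz !mul0r.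
have rp : 0 < r by rewrite lt_neqAle eq_sym rN0 enorm_ge0.
have rd : r <= d := diam_ge bO Ox Oz.
have dp : 0 < d := lt_le_trans rp rd.
have a0 : 0 < r / d by rewrite divr_gt0.
apply: (@le_trans _ _ ((G z * r)%:E *
    \int[lam]_(t in `[(r / d)%R, 1%R]) (t `^ (- N.+1%:R))%:E)%E).
  rewrite -ge0_integralZl//; last 3 first.
  - by apply: measurable_funTS; apply/measurable_EFinP.
  - by move=> t _; rewrite lee_fin powR_ge0.
  - by rewrite lee_fin mulr_ge0// ltW.
  rewrite [leRHS]integral_mkcond le_eqVlt; apply/orP; left; apply/eqP.
  apply: eq_integral => t _; rewrite patchE /B/= -/r -EFinM.
  rewrite -ler_pdivrMr// indicE.
  (* Since r / d > 0, the constraint r / d <= t already forces t > 0. *)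
  have -> : (t \in `[(r / d)%R, 1%R]%classic) = (r / d <= t) && (t \in `]0%R, 1%R]%classic).
    apply/idP/andP; rewrite !inE/= !in_itv/=.
      by move=> /andP[at1 ->]; rewrite at1 (lt_le_trans a0 at1).
    by move=> [-> /andP[]].
  by case: (r / d <= t); case: (t \in _) => /=; rewrite ?mulr1 ?mulr0.
have := integral_powRN_le N0 a0; move=> /(lee_wpmul2l _) h.
apply: le_trans (h _ _) _; first by rewrite lee_fin mulr_ge0// ltW.
rewrite -EFinM lee_fin powRB ?rN0 ?implybT// powRr1 ?(ltW rp)// powR_mulrn ?(ltW rp)//.
rewrite le_eqVlt; apply/orP; left; apply/eqP.
have NN : (N%:R : R) != 0 by rewrite pnatr_eq0 -lt0n.
rewrite expr_div_n; field.
by rewrite NN !expf_neq0// gt_eqF.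
Qed.

End riesz.

(** * Proof of the inequality *)

Section hoelder_extended.
Context d (T : measurableType d) (R : realType) (mu : {measure set T -> \bar R}).

Lemma hoelder_conjugate_EFin (r : R) : 1 < r ->
  hoelder_conjugate r%:E = (r / (r - 1))%:E.
Proof.
move=> r1; rewrite /hoelder_conjugate/=.
have -> : (r%:E == 0)%E = false by apply/negbTE; rewrite eqe gt_eqF// (lt_trans _ r1).
by rewrite -EFinB inver subr_eq0 gt_eqF// -EFinM.
Qed.

(** For q = +oo the factor f is bounded almost everywhere by its essential supremum, and the
    conjugate norm is the L1 norm. *)
Lemma hoelder_extended (f g : T -> R) (q : \bar R) :
  measurable_fun setT f -> measurable_fun setT g -> (1 < q)%E ->
  (\int[mu]_x `|(f x * g x)%:E| <=
   Lnorm mu q (EFin \o f) * Lnorm mu (hoelder_conjugate q) (EFin \o g))%E.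
Proof.
move=> mf mg; case: q => [r| |//].
  rewrite lte_fin => r1; rewrite hoelder_conjugate_EFin//.
  have r0 : 0 < r by rewrite (lt_trans _ r1).
  have r10 : 0 < r - 1 by rewrite subr_gt0.
  have := @hoelder _ _ _ mu f g r (r / (r - 1)) mf mg r0.
  rewrite Lnorm1; apply; first exact: divr_gt0.
  rewrite invf_div; field; exact: lt0r_neq0.
move=> _; rewrite hoelder_conjugatey Lnorm1 unlock.
have mfg : measurable_fun setT (fun x => `|(f x * g x)%:E|%E).
  by apply: measurableT_comp => //; apply/measurable_EFinP; exact: measurable_funM.
have mag : measurable_fun setT (fun x => `|(EFin \o g) x|%E).
  by apply: measurableT_comp => //; exact/measurable_EFinP.
case: ifPn => [muT|].
  have e0 : (0 <= ess_sup mu (abse \o (EFin \o f)))%E.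
    by apply: ess_sup_gee => //; apply: aeW => x; exact: abse_ge0.
  rewrite -ge0_integralZl//.
  apply: ae_ge0_le_integral => //.
  - by move=> x _; rewrite mule_ge0.
  - exact: emeasurable_funM.
  have := ess_sup_ge mu (abse \o (EFin \o f)); apply: filterS => x fx _ /=.
  by rewrite normrM EFinM lee_wpmul2r.
(* On a null space the L^oo norm is 0 by definition, and the left side vanishes as well. *)
rewrite -leNgt measure_le0 => /eqP muT.
rewrite mul0e integral_abs_eq0//.
by apply/measurable_EFinP; exact: measurable_funM.
Qed.

End hoelder_extended.

(** * From increments for fixed h to averages over Omega *)

Section difference_quotient.
Context {R : realType} {N : nat}.
Local Notation mu := (@lebesgue_rV R N).
Local Notation lam := (@lebesgue_measure R).

(** The interval leaves out t = 0, where the substitution dividing by t breaks down; this changes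
    the integral over [0, 1] by a null set only. *)
Definition segment_majorant (G : 'rV[R]_N -> R) (x h : 'rV[R]_N) : \bar R :=
  (\int[lam]_t (G (x + t *: h)%R * enorm h * \1_`]0%R, 1%R] t)%:E)%E.

Lemma measurable_segment_majorant (G : 'rV[R]_N -> R) :
  measurable_fun setT G -> (forall z, 0 <= G z) ->
  measurable_fun setT (fun p : 'rV[R]_N * 'rV[R]_N => segment_majorant G p.1 p.2).
Proof.
move=> mG G0; pose T := (('rV[R]_N * 'rV[R]_N) * measurableTypeR R)%type.
have m1 : measurable_fun setT (fst : T -> _) by exact: measurable_fst.
have m2 : measurable_fun setT (snd : T -> _) by exact: measurable_snd.
have m11 : measurable_fun setT (fun p : T => p.1.1).
  exact: (measurableT_comp measurable_fst m1).
have m12 : measurable_fun setT (fun p : T => p.1.2).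
  exact: (measurableT_comp measurable_snd m1).
apply: (measurable_fun_fubini_tonelli_F (fun p : T =>
  (G (p.1.1 + p.2 *: p.1.2)%R * enorm p.1.2 * \1_`]0%R, 1%R] p.2)%:E)).
- apply/measurable_EFinP; apply: measurable_funM.
    apply: measurable_funM.
      by apply: (measurableT_comp mG); exact: measurable_rV_line.
    exact: (measurableT_comp measurable_enorm m12).
  by apply: measurableT_comp m2; exact: measurable_indic.
- by move=> p; rewrite lee_fin !mulr_ge0 ?enorm_ge0.
Qed.

Lemma segment_integral_le (g G : 'rV[R]_N -> R) (x h : 'rV[R]_N) :
  measurable_fun setT g -> measurable_fun setT G ->
  (forall z, `|g z| <= G z * enorm h) ->
  (`|fine (segment_integral g x h)|%:E <= segment_majorant G x h)%E.
Proof.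
move=> mg mG gG.
have G0 z : 0 <= G z * enorm h by exact: le_trans (gG z).
have ml : measurable_fun setT (fun t : measurableTypeR R => x + t *: h).
  exact: (@measurable_rV_line R N _ (measurableTypeR R) (fun=> x) (fun=> h) id).
have mgl : measurable_fun setT (fun t : measurableTypeR R => g (x + t *: h)).
  exact: (measurableT_comp mg ml).
have mGl : measurable_fun setT (fun t : measurableTypeR R => G (x + t *: h)).
  exact: (measurableT_comp mG ml).
have mi (I : interval R) : measurable_fun setT (fun t : measurableTypeR R => \1_[set` I] t : R).
  exact: measurable_indic.
(* An infinite segment integral has [fine] equal to 0, so the comparison holds there too. *)
apply: (@le_trans _ _ `|segment_integral g x h|%E).
  by case: (segment_integral g x h) => [r| |]//=; rewrite normr0 leey.
apply: (le_trans (le_abse_integral _ _ _)) => //.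
  by apply/measurable_EFinP; exact: measurable_funM.
have mI : measurable (`[0%R, 1%R]%classic : set (measurableTypeR R)) by [].
rewrite /segment_majorant.
apply: (@le_trans _ _ (\int[lam]_(t in `[0%R, 1%R]) (G (x + t *: h)%R * enorm h)%:E)%E).
  rewrite [leRHS]integral_mkcond; apply: ge0_le_integral => //.
  - by apply/measurable_EFinP; apply: measurableT_comp => //; exact: measurable_funM.
  - apply/(measurable_restrictT _ mI); apply: measurable_funTS.
    by apply/measurable_EFinP; exact: measurable_funM.
  - move=> t _; rewrite patchE indicE; case: ifPn => _.
      by rewrite mulr1 lee_fin.
    by rewrite mulr0 abse0.
rewrite -integral_itv_obnd_cbnd; last first.
  by apply: measurable_funTS; apply/measurable_EFinP; exact: measurable_funM.
rewrite integral_mkcond le_eqVlt; apply/orP; left; apply/eqP.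
apply: eq_integral => t _; rewrite patchE indicE; case: ifPn => _.
  by rewrite mulr1.
by rewrite mulr0.
Qed.

(** Exchanges the quantifiers: the pairs violating the bound form a measurable set with null slices
    at each h, so by Tonelli its slices at almost every x are null. For such x the bound is
    integrated over h. *)
Lemma ae_difference_bound (Omega : set 'rV[R]_N) (u G : 'rV[R]_N -> R) :
  open Omega -> measurable_fun setT u -> measurable_fun setT G ->
  (forall z, 0 <= G z) ->
  (forall h, {ae mu, forall x, Omega x -> Omega (x + h) ->
     (`|u (x + h) - u x|%:E <= segment_majorant G x h)%E}) ->
  {ae mu, forall x, Omega x ->
    (\int[mu]_(y in Omega) `|u y - u x|%:E <=
     \int[mu]_y \int[lam]_t
       (\1_Omega y * (G (x + t *: (y - x)) * enorm (y - x) * \1_`]0%R, 1%R] t))%:E)%E}.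
Proof.
move=> oO mu_ mG G0 H.
have mO := open_measurable_rV oO.
have mOi : measurable_fun setT (\1_Omega : 'rV[R]_N -> R) by exact: measurable_indic.
pose T := ('rV[R]_N * 'rV[R]_N)%type.
(* The indicators absorb both membership conditions, so that a bad pair is one strict inequality
   between measurable functions. *)
pose P (p : T) := \1_Omega p.1 * (\1_Omega (p.1 + p.2) * `|u (p.1 + p.2) - u p.1|).
pose S (p : T) := segment_majorant G p.1 p.2.
pose Bd : set T := [set p | (S p < (P p)%:E)%E].
have m1 : measurable_fun setT (fst : T -> _) by exact: measurable_fst.
have m2 : measurable_fun setT (snd : T -> _) by exact: measurable_snd.
have m12 : measurable_fun setT (fun p : T => p.1 + p.2).
  rewrite (_ : (fun _ => _) = (fun p : T => p.1 + 1 *: p.2)).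
    exact: measurable_rV_line.
  by apply/funext => p; rewrite scale1r.
have mP : measurable_fun setT P.
  apply: measurable_funM; first exact: (measurableT_comp mOi m1).
  apply: measurable_funM; first exact: (measurableT_comp mOi m12).
  apply: measurableT_comp => //; apply: measurable_funB.
    exact: (measurableT_comp mu_ m12).
  exact: (measurableT_comp mu_ m1).
have mS : measurable_fun setT S := measurable_segment_majorant mG G0.
have mBd : measurable Bd.
  by rewrite -[Bd]setTI; apply: measurable_lte => //; exact/measurable_EFinP.
have S0 x h : (0 <= S (x, h))%E.
  by apply: integral_ge0 => t _; rewrite lee_fin !mulr_ge0 ?enorm_ge0.
pose f (p : T) : \bar R := (\1_Bd p)%:E.
have mf : measurable_fun setT f by apply/measurable_EFinP; exact: measurable_indic.
have f0 p : (0 <= f p)%E by rewrite lee_fin.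
have F0 : (\int[mu]_x \int[mu]_h f (x, h) = 0)%E.
  rewrite (fubini_tonelli f)//.
  rewrite integral0_eq// => h _.
  rewrite (ae_eq_integral (cst 0%E))//; first by rewrite integral0.
  - exact: measurable_fun_pair1 mf.
  - have := H h; apply: filterS => x Hx _ /=; rewrite /f indicE memNset//.
    rewrite /Bd/= /P /S/=; apply/negP; rewrite -leNgt !indicE.
    have [Ox|_] := boolP (x \in Omega); last by rewrite mul0r; exact: S0.
    have [Oxh|_] := boolP (x + h \in Omega); last by rewrite mul0r mulr0; exact: S0.
    by rewrite !mul1r; apply: Hx; exact: set_mem.
have mF : measurable_fun setT (fun x => \int[mu]_h f (x, h))%E.
  exact: measurable_fun_fubini_tonelli_F.
have : ae_eq mu setT (fun x => \int[mu]_h f (x, h))%E (cst 0%E).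
  apply/(ae_eq_integral_abs mu measurableT mF).
  rewrite -[RHS]F0; apply: eq_integral => x _; rewrite gee0_abs//.
  exact: integral_ge0.
apply: filterS => x /(_ I) /= fx0 Ox.
have fx : ae_eq mu setT (fun h => f (x, h)) (cst 0%E).
  have mfx : measurable_fun setT (fun h => f (x, h)) := measurable_fun_pair2 x mf.
  apply/(ae_eq_integral_abs mu measurableT mfx).
  by rewrite -[RHS]fx0; apply: eq_integral => h _; rewrite gee0_abs.
pose K y : \bar R := (\1_Omega y * `|u y - u x|)%:E.
pose L y : \bar R := ((\1_Omega y)%:E * S (x, (y - x)%R))%E.
have mx : measurable_fun setT (fun y : 'rV[R]_N => y - x).
  exact: (measurable_translate (- x)).
have mSx : measurable_fun setT (fun h => S (x, h)) := measurable_fun_pair2 x mS.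
have mK : measurable_fun setT K.
  apply/measurable_EFinP; apply: measurable_funM => //.
  by apply: measurableT_comp => //; exact: measurable_funB.
have mL : measurable_fun setT L.
  apply: emeasurable_funM; first exact/measurable_EFinP.
  exact: (measurableT_comp mSx mx).
have K0 y : (0 <= K y)%E by rewrite lee_fin mulr_ge0.
have L0 y : (0 <= L y)%E by rewrite mule_ge0.
have -> : (\int[mu]_(y in Omega) `|u y - u x|%:E = \int[mu]_y K y)%E.
  rewrite integral_mkcond; apply: eq_integral => y _; rewrite patchE /K indicE.
  by case: ifPn => _; rewrite ?mul1r ?mul0r.
have <- : (\int[mu]_y L y = \int[mu]_y \int[lam]_t
    (\1_Omega y * (G (x + t *: (y - x)) * enorm (y - x) * \1_`]0%R, 1%R] t))%:E)%E.
  apply: eq_integral => y _; rewrite /L [\1_Omega y]indicE.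
  case: (y \in Omega) => /=.
    by rewrite mul1e; apply: eq_integral => t _; rewrite mul1r.
  by rewrite mul0e integral0_eq// => t _; rewrite mul0r.
(* Sets y = h + x, so that both integrands are compared at almost every h. *)
rewrite -(ge0_integral_translate x mK)// -(ge0_integral_translate x mL)//.
apply: ae_ge0_le_integral => //.
- exact: (measurableT_comp mK (measurable_translate x)).
- exact: (measurableT_comp mL (measurable_translate x)).
apply: filterS fx => h /(_ I) /= fxh _.
have nBd : ~ Bd (x, h).
  move=> Bxh; have : f (x, h) = 1%E by rewrite /f indicE mem_set.
  by rewrite fxh => /eqP; rewrite eq_sym onee_eq0.
have PS : ((P (x, h))%:E <= S (x, h))%E by rewrite leNgt; exact/negP.
rewrite /L addrK /K [h + x]addrC indicE.
have [Oxh|_] := boolP (x + h \in Omega); last by rewrite mul0r mul0e.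
rewrite mul1e mul1r; apply: le_trans PS.
by rewrite /P/= !indicE Oxh mem_set// !mul1r.
Qed.

End difference_quotient.

(** * Integrability, reflection, directional weak derivatives *)

Section sobolev_tools.
Context {R : realType} {N : nat}.
Local Notation mu := (@lebesgue_rV R N).

(** Hoelder against the indicator of Omega, whose conjugate norm is finite because Omega has finite
    measure. *)
Lemma Lnorm_integrable (Omega : set 'rV[R]_N) (f : 'rV[R]_N -> R) (q : \bar R) :
  (1 < q)%E -> measurable Omega -> (mu Omega < +oo)%E ->
  measurable_fun setT f -> (forall x, ~ Omega x -> f x = 0) ->
  (Lnorm mu q (EFin \o f) < +oo)%E -> mu.-integrable setT (EFin \o f).
Proof.
move=> q1 mO Ooo mf fO fq; apply/integrableP; split; first exact/measurable_EFinP.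
have mI : measurable_fun setT (\1_Omega : 'rV[R]_N -> R) by exact: measurable_indic.
have -> : (\int[mu]_x `|(EFin \o f) x| = \int[mu]_x `|(f x * \1_Omega x)%:E|)%E.
  apply: eq_integral => x _ /=; rewrite indicE.
  have [_|/negP xO] := boolP (x \in Omega); first by rewrite mulr1.
  by rewrite mulr0 fO// => /mem_set.
apply: le_lt_trans (hoelder_extended mu mf mI q1) _.
have [r [r0 ->]] : exists r, 0 < r /\ hoelder_conjugate q = r%:E.
  case: q q1 {fq} => [r| |//]; last by exists 1.
  rewrite lte_fin => r1; exists (r / (r - 1)); rewrite hoelder_conjugate_EFin//.
  by split=> //; rewrite divr_gt0 ?subr_gt0// (lt_trans _ r1).
apply: lte_mul_pinfty; first exact: Lnorm_ge0.
  by rewrite ge0_fin_numE// Lnorm_ge0.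
rewrite unlock; apply: poweR_lty.
apply: le_lt_trans Ooo.
have <- : (\int[mu]_x (\1_Omega x)%:E = mu Omega)%E by rewrite integral_indic// setIT.
rewrite le_eqVlt; apply/orP; left; apply/eqP; apply: eq_integral => x _ /=.
rewrite indicE; case: (x \in Omega); rewrite /= ?normr1 ?powR1// normr0 powR0//.
by rewrite gt_eqF.
Qed.

Lemma Lnorm_reflect (x : 'rV[R]_N) (f : 'rV[R]_N -> R) (r : R) :
  measurable_fun setT f ->
  Lnorm mu r%:E (EFin \o (fun z => f (x - z))) = Lnorm mu r%:E (EFin \o f).
Proof.
move=> mf; rewrite unlock; congr poweR.
have c0 : (-1 : R) != 0 by rewrite oppr_eq0 oner_eq0.
have mfr : measurable_fun setT (fun z => `|(EFin \o f) z| `^ r)%E.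
  apply: (@measurableT_comp _ _ _ _ _ _ (fun y : \bar R => y `^ r)%E).
    exact: measurable_poweR.
  by apply: measurableT_comp => //; exact/measurable_EFinP.
rewrite [RHS](ge0_integral_affine x c0 mfr); last by move=> z; exact: poweR_ge0.
rewrite normrN1 expr1n mul1e; apply: eq_integral => z _ /=.
by rewrite scaleN1r addrC.
Qed.

(** Provides the hypothesis of [weak_line] for the directional derivative gradu . h: the coordinate
    identities are summed with weights h_i. Integrability makes all integrals finite, so that
    real-valued identities lift to the extended reals. *)
Lemma weak_gradient_dir (Omega : set 'rV[R]_N) (u : 'rV[R]_N -> R)
    (gradu : 'rV[R]_N -> 'rV[R]_N) (h a b : 'rV[R]_N) (f : 'I_N -> R -> R) :
  weak_gradient Omega u gradu ->
  mu.-integrable setT (EFin \o (u \_ Omega)) ->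
  (forall i, mu.-integrable setT (EFin \o ((fun x => gradu x ord0 i) \_ Omega))) ->
  bumps_on a b f -> cbox a b `<=` Omega ->
  (\int[mu]_x ((\sum_i h ord0 i * ((fun x => gradu x ord0 i) \_ Omega) x) *
     prodf f x)%:E =
   \int[mu]_x (- ((u \_ Omega) x * \sum_i h ord0 i * prodf (diff_at f i) x))%:E)%E.
Proof.
move=> [_ wu] iu ig Df abO.
pose g i := (fun x => gradu x ord0 i) \_ Omega.
have [C CP] := prodf_bounded Df.
have mf := measurable_prodf Df.
have Dd i : bumps_on a b (diff_at f i) := bumps_on_diff_at i Df.
have ig1 i : mu.-integrable setT (EFin \o (fun x => g i x * prodf f x)).
  exact: (integrable_mul_bounded (ig i) mf CP).
have iu1 i : mu.-integrable setT (EFin \o (fun x => (u \_ Omega) x * prodf (diff_at f i) x)).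
  have [D DP] := prodf_bounded (Dd i).
  exact: (integrable_mul_bounded iu (measurable_prodf (Dd i)) DP).
have E i : (\int[mu]_x (g i x * prodf f x)%:E =
    - \int[mu]_x ((u \_ Omega) x * prodf (diff_at f i) x)%:E)%E.
  have [_ /(_ _ (prodf_test_function Df abO))] := wu i.
  have patchM (v w : 'rV[R]_N -> R) : (\int[mu]_(x in Omega) (v x * w x)%:E =
      \int[mu]_x ((v \_ Omega) x * w x)%:E)%E.
    rewrite integral_mkcond; apply: eq_integral => x _; rewrite !patchE.
    by case: ifP => //; rewrite mul0r.
  rewrite (partial_prodf i Df) /Rintegral !patchM -/(g i).
  have f1 := integrable_fin_num measurableT (ig1 i).
  have f2 := integrable_fin_num measurableT (iu1 i).
  move=> e; rewrite -[LHS](fineK f1) -(fineK f2) -EFinN; congr EFin.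
  by apply: (canRL opprK); exact: (esym e).
transitivity (\sum_i (h ord0 i)%:E * \int[mu]_x (g i x * prodf f x)%:E)%E.
  under eq_integral => x _.
    rewrite mulr_suml -sumEFin.
    under eq_bigr do rewrite -mulrA EFinM.
    over.
  rewrite integral_sum//; last by move=> i; apply: integrableZl => //; exact: ig1.
  apply: eq_bigr => i _; rewrite integralZl//; exact: ig1.
transitivity (\sum_i (- h ord0 i)%:E * \int[mu]_x ((u \_ Omega) x * prodf (diff_at f i) x)%:E)%E.
  by apply: eq_bigr => i _; rewrite E muleN EFinN mulNe.
under [RHS]eq_integral => x _.
  rewrite -mulrN -sumrN mulr_sumr -sumEFin.
  under eq_bigr do rewrite -mulNr mulrCA EFinM.
  over.
rewrite integral_sum//; last by move=> i; apply: integrableZl => //; exact: iu1.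
apply: eq_bigr => i _; rewrite integralZl//; exact: iu1.
Qed.

Lemma convex_segment (Omega : set 'rV[R]_N) (x h : 'rV[R]_N) (t : R) :
  convex_set Omega -> Omega x -> Omega (x + h) -> 0 <= t <= 1 ->
  Omega (x + t *: h).
Proof.
move=> cO Ox Oxh t01.
(* The parameter of [conv] is the weight of its first point, here x, hence 1 - t. *)
have t01' : 0 <= 1 - t <= 1 by case/andP: t01 => ? ?; apply/andP; split; lra.
have := cO x (x + h) (Itv01 (proj1 (andP t01')) (proj2 (andP t01'))).
move=> /(_ (mem_set Ox) (mem_set Oxh)) /set_mem.
congr Omega; rewrite /conv/= /unstable.onem subKr scalerDr addrA -scalerDl.
by rewrite subrK scale1r.
Qed.

End sobolev_tools.

(** * The difference set and positivity of the constant *)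

Section geometry.
Context {R : realType} {N : nat}.
Local Notation mu := (@lebesgue_rV R N).

Lemma open_difference_set (Omega : set 'rV[R]_N) :
  open Omega -> open (difference_set Omega).
Proof.
move=> oO; rewrite (_ : difference_set Omega =
    \bigcup_(y in Omega) [set z | Omega (z + y)]).
  by apply: bigcup_open => y _; exact: open_translate.
apply/seteqP; split => [_ [x Ox [y Oy <-]]|z [y Oy /= Ozy]].
  by exists y => //=; rewrite subrK.
by exists (z + y) => //; exists y => //; rewrite addrK.
Qed.

Lemma domain_two_points (Omega : set 'rV[R]_N) :
  (0 < N)%N -> open Omega -> Omega !=set0 ->
  exists x y, [/\ Omega x, Omega y & x != y].
Proof.
move=> N0 oO [x Ox]; have [e e0 xe] := open_rV_cube oO Ox.
pose y : 'rV[R]_N := x + const_mx (e / 2).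
exists x, y; split=> //.
  apply: xe => i; rewrite !mxE opprD addNKr normrN gtr0_norm; lra.
apply/eqP => /rowP /(_ (Ordinal N0)); rewrite !mxE => xx.
have : e / 2 = 0 by apply: (addrI (x ord0 (Ordinal N0))); rewrite -xx addr0.
by move/eqP; rewrite gt_eqF// divr_gt0.
Qed.

Lemma diam_gt0 (Omega : set 'rV[R]_N) :
  (0 < N)%N -> open Omega -> Omega !=set0 -> bounded_set Omega ->
  0 < diam Omega.
Proof.
move=> N0 oO O0 bO; have [x [y [Ox Oy xy]]] := domain_two_points N0 oO O0.
apply: lt_le_trans (diam_ge bO Ox Oy).
rewrite lt_neqAle enorm_ge0 andbT eq_sym; apply: contra xy => /eqP/enorm_eq0/eqP.
by rewrite subr_eq0.
Qed.

(** Rules out the product 0 * +oo = 0 on the right of the inequality when the gradient has infinite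
    norm. The kernel can vanish only at the origin, and V without the origin is open and
    nonempty. *)
Lemma Lnorm_difference_set_gt0 (Omega : set 'rV[R]_N) (p : \bar R) (s : R) :
  (0 < N)%N -> open Omega -> Omega !=set0 -> (0 < p)%E ->
  (0 < LnormOn (difference_set Omega) p (fun x => (enorm x `^ s)%R))%E.
Proof.
move=> N0 oO O0 p0; rewrite lt_neqAle Lnorm_ge0 andbT eq_sym.
apply/eqP => L0; set V := difference_set Omega in L0.
have oV : open V := open_difference_set oO.
have mk : measurable_fun setT ((fun x : 'rV[R]_N => enorm x `^ s) \_ V).
  apply/(measurable_restrictT _ (open_measurable_rV oV)); apply: measurable_funTS.
  have mq : measurable_fun setT (fun t : R => t `^ s) by exact: measurable_powR.
  exact: (measurableT_comp mq measurable_enorm).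
have [A [mA A0 subA]] := Lnorm_eq0_eq0 ((measurable_EFinP _ _).2 mk) p0 L0.
pose W := V `&` ~` [set (0 : 'rV[R]_N)].
have oW : open W.
  apply: openI => //; apply: closed_openC.
  have h : hausdorff_space 'rV[R]_N := @norm_hausdorff _ _.
  exact: (accessible_closed_set1 (hausdorff_accessible h)).
have W0 : W !=set0.
  have [x [y [Ox Oy xy]]] := domain_two_points N0 oO O0.
  exists (x - y); split; first by exists x => //; exists y.
  by move=> /= /eqP; rewrite subr_eq0; exact/negP.
have WA : W `<=` A.
  move=> x [Vx x0]; apply: subA => /= /(_ I) /eqP; rewrite patchE mem_set// eqe.
  by rewrite powR_eq0 => /andP[/eqP/enorm_eq0].
have := open_lebesgue_gt0 oW W0; rewrite ltNge => /negP; apply.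
rewrite -A0; apply: le_measure; rewrite ?inE//; exact: open_measurable_rV.
Qed.

End geometry.

Unset Implicit Arguments.

(* Given u in the Sobolev space, its weak gradient is unique only up to null
   sets, whence the quantification over all its versions gradu. *)
Theorem theorem4p4 (R : realType) (N : nat) (Omega : set 'rV[R]_N)
    (q : \bar R) :
  (0 < N)%N ->
  domain Omega -> bounded_set Omega -> convex_set Omega ->
  (N%:R%:E < q)%E ->
  forall (u : 'rV[R]_N -> R) (gradu : 'rV[R]_N -> 'rV[R]_N),
    sobolev1 Omega q u -> weak_gradient Omega u gradu ->
    (LnormOn Omega +oo (fun x => (u x - mean Omega u)%R) <=
     D_infty Omega q * LnormOn Omega q (fun x => enorm (gradu x)))%E.
Proof.
move=> N0 [neO oO _] bO cO Nq u gradu [uq _] wu.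
pose mu := @lebesgue_rV R N.
have q1 : (1 < q)%E by apply: le_lt_trans Nq; rewrite lee_fin ler1n.
have mO := open_measurable_rV oO.
have Ooo := bounded_lebesgue_lty bO mO.
have Ogt := open_lebesgue_gt0 oO neO.
set d := diam Omega; set m := volume Omega.
have d0 : 0 < d := diam_gt0 N0 oO neO bO.
have mE : lebesgue_rV N Omega = m%:E by rewrite fineK// ge0_fin_numE.
have m0 : 0 < m by rewrite -lte_fin -mE.
pose G := (fun x => enorm (gradu x)) \_ Omega.
pose p := hoelder_conjugate q.
have [r r0 pr] : exists2 r, 0 < r & p = r%:E.
  rewrite /p; case: q q1 {Nq uq p} => [r| |//]; last by exists 1.
  rewrite lte_fin => r1; exists (r / (r - 1)); last by rewrite hoelder_conjugate_EFin.
  by rewrite divr_gt0 ?subr_gt0// (lt_trans _ r1).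
pose V := difference_set Omega.
have oV : open V := open_difference_set oO.
pose k := (fun x : 'rV[R]_N => enorm x `^ (1 - N%:R)) \_ V.
rewrite /D_infty /LnormOn -/d -/m -/p -/V -/k -/G.
have dN0 : 0 < d ^+ N / (N%:R * m) by rewrite divr_gt0 ?exprn_gt0// mulr_gt0// ltr0n.
have Lk0 : (0 < Lnorm mu p (EFin \o k))%E.
  by apply: Lnorm_difference_set_gt0 => //; rewrite pr lte_fin.
(* With a positive constant, an infinite gradient norm makes the right-hand side +oo. *)
have [Goo|Goo] := eqVneq (Lnorm mu q (EFin \o G)) +oo%E.
  by rewrite Goo gt0_muley ?leey// mule_gt0.
have {}Goo : (Lnorm mu q (EFin \o G) < +oo)%E by rewrite ltey.
have [lu wg] := wu.
have mOr : measurable_fun setT (u \_ Omega).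
  by apply/(measurable_restrictT _ mO); case: lu.
have mgi i : measurable_fun setT ((fun x => gradu x ord0 i) \_ Omega).
  by apply/(measurable_restrictT _ mO); case: (wg i) => -[].
(* The gradient extended by 0: [gradu] is known to be measurable on Omega only, [g0] on the whole
   space. *)
pose g0 x : 'rV[R]_N := \row_i ((fun x => gradu x ord0 i) \_ Omega) x.
have g0O x : Omega x -> g0 x = gradu x.
  by move=> Ox; apply/rowP => i; rewrite mxE patchE mem_set.
have mg0 : measurable_fun setT g0.
  by apply: measurable_fun_coorP => i; under eq_fun do rewrite mxE; exact: mgi.
have GE : G = (fun x => enorm (g0 x)).
  apply/funext => x; rewrite /G patchE; case: ifPn => [/set_mem/g0O ->//|xO].
  rewrite (_ : g0 x = 0); last by apply/rowP => i; rewrite !mxE patchE (negbTE xO).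
  by rewrite /enorm big1 ?sqrtr0// => i _; rewrite mxE expr0n.
have mG : measurable_fun setT G.
  by rewrite GE; exact: (measurableT_comp measurable_enorm mg0).
have G0 z : 0 <= G z by rewrite GE enorm_ge0.
have GO z : ~ Omega z -> G z = 0.
  by move=> zO; rewrite /G patchE memNset.
have iG : mu.-integrable setT (EFin \o G) := Lnorm_integrable q1 mO Ooo mG GO Goo.
have iu : mu.-integrable setT (EFin \o (u \_ Omega)).
  apply: (Lnorm_integrable q1 mO Ooo mOr).
    by move=> x xO; rewrite patchE memNset.
  by move: uq; rewrite /LfunOn !inE => /andP[_]; rewrite inE.
have ig i : mu.-integrable setT (EFin \o ((fun x => gradu x ord0 i) \_ Omega)).
  apply: (le_integrable measurableT _ _ iG); first exact/measurable_EFinP.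
  move=> x _; rewrite lee_fin [leRHS]ger0_norm// GE.
  by have := le_coord_enorm (g0 x) i; rewrite mxE.
have bound h : {ae mu, forall x, Omega x -> Omega (x + h) ->
    (`|(u \_ Omega) (x + h) - (u \_ Omega) x|%:E <= segment_majorant G x h)%E}.
  pose gh x := \sum_i h ord0 i * ((fun x => gradu x ord0 i) \_ Omega) x.
  have mgh : measurable_fun setT gh.
    by apply: measurable_sum => i; exact: measurable_funM.
  have ghG z : `|gh z| <= G z * enorm h.
    rewrite mulrC GE; have := CauchySchwarz_enorm h (g0 z).
    by under eq_bigr do rewrite mxE.
  have igh : mu.-integrable setT (EFin \o gh).
    apply: (le_integrable measurableT _ _ (integrableZl measurableT (enorm h) iG)).
      exact/measurable_EFinP.
    move=> x _; rewrite lee_fin (le_trans (ghG x))// mulrC ger0_norm//.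
    by rewrite mulr_ge0 ?enorm_ge0.
  have := weak_line oO (fun x t => @convex_segment R N Omega x h t cO) iu igh
    (fun a b f Df abO => weak_gradient_dir h wu iu ig Df abO).
  apply: filterS => x Hx Ox Oxh; rewrite Hx//.
  exact: segment_integral_le.
have := ae_difference_bound oO mOr mG G0 bound.
(* [Lnorm] at +oo is an essential supremum only on a space of positive measure. *)
have muT : (0 < mu setT)%E.
  by apply: open_lebesgue_gt0; [exact: openT|exists 0].
have LE (f : 'rV[R]_N -> \bar R) : Lnorm mu +oo f = ess_sup mu (abse \o f).
  by rewrite unlock muT.
move=> H; rewrite LE; apply/ess_supP; move: H; apply: filterS => x Hx /=.
rewrite patchE; case: ifPn => [/set_mem Ox|_]; last first.
  by rewrite normr0 !mule_ge0 ?Lnorm_ge0// lee_fin ltW.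
have {Hx} := le_trans (Hx Ox) (segment_riesz N0 oO bO Ox mG G0 GO).
rewrite -/d.
have mk : measurable_fun setT k.
  apply/(measurable_restrictT _ (open_measurable_rV oV)); apply: measurable_funTS.
  have mq : measurable_fun setT (fun t : R => t `^ (1 - N%:R)) by exact: measurable_powR.
  exact: (measurableT_comp mq measurable_enorm).
have mkx : measurable_fun setT (fun z : 'rV[R]_N => k (x - z)).
  have mxz : measurable_fun setT (fun z : 'rV[R]_N => x - z).
    rewrite (_ : (fun _ => _) = (fun z : 'rV[R]_N => (-1) *: z + x)).
      exact: measurable_rV_affine.
    by apply/funext => z; rewrite scaleN1r addrC.
  exact: (measurableT_comp mk mxz).
have hold : (\int[mu]_z (G z * enorm (x - z) `^ (1 - N%:R))%:E <=
    Lnorm mu q (EFin \o G) * Lnorm mu p (EFin \o k))%E.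
  (* The reflection z |-> x - z preserves the norm of k, so the bound does not depend on x. *)
  have := hoelder_extended mu mG mkx q1; rewrite -/p {1}pr Lnorm_reflect// -pr.
  apply: le_trans; rewrite le_eqVlt; apply/orP; left; apply/eqP.
  apply: eq_integral => z _; have [Oz|/GO ->] := pselect (Omega z); last first.
    by rewrite !mul0r abse0.
  rewrite /k patchE mem_set; last by exists x => //; exists z.
  by rewrite gee0_abs// lee_fin mulr_ge0// powR_ge0.
have iuO : mu.-integrable Omega (EFin \o u).
  apply/(integrable_mkcond _ mO); apply: eq_integrable iu => // z _.
  by rewrite /= !patchE; case: ifP.
have icO : mu.-integrable Omega (EFin \o (fun=> u x)).
  apply/integrableP; split; first exact/measurable_EFinP/measurable_cst.
  by rewrite /= integral_cst// lte_mul_pinfty// mE ltry.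
(* m (u x - mean) is the integral of u x - u y over y in Omega, whose absolute value is at most the
   integral of the absolute value. *)
have low : ((m * `|u x - mean Omega u|)%:E <=
    \int[mu]_(y in Omega) `|(u \_ Omega) y - (u \_ Omega) x|%:E)%E.
  have -> : (\int[mu]_(y in Omega) `|(u \_ Omega) y - (u \_ Omega) x|%:E =
      \int[mu]_(y in Omega) `|(u y)%:E - (u x)%:E|)%E.
    by apply: eq_integral => y yO; rewrite !patchE yO mem_set.
  apply: le_trans (le_abse_integral _ _ _) => //; last first.
    by apply: emeasurable_funB; [exact: measurable_int iuO|exact: measurable_int icO].
  rewrite integralB_EFin// integral_cst//.
  have uf := integrable_fin_num mO iuO.
  have -> : m * `|u x - mean Omega u| = `|\int[mu]_(y in Omega) u y - u x * m|.
    rewrite -{1}(gtr0_norm m0) -normrM distrC /mean -/m mulrBr mulrA divff ?gt_eqF//.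
    by rewrite mul1r [m * u x]mulrC.
  rewrite -(fineK uf).
  by rewrite [X in (_ * X)%E]mE -EFinM -EFinB.
(* Multiplying by the finite positive volume m matches [low] and cancels the 1 / m in the
   constant. *)
move=> up; rewrite -(@lee_pmul2l _ m%:E)//.
apply: (@le_trans _ _ ((d ^+ N / N%:R)%:E *
    (Lnorm mu q (EFin \o G) * Lnorm mu p (EFin \o k)))%E).
  rewrite -EFinM; apply: le_trans low _; apply: le_trans up _.
  by rewrite lee_pmul2l// lte_fin divr_gt0 ?exprn_gt0// ltr0n.
rewrite -(muleA _ (Lnorm mu p _)) (muleA m%:E) -EFinM.
have -> : m * (d ^+ N / (N%:R * m)) = d ^+ N / N%:R.
  by field; rewrite pnatr_eq0 -lt0n N0 gt_eqF.
by rewrite [(Lnorm mu p _ * _)%E]muleC.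
Qed.
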